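(* Let $(M^5,g,\xi,\eta,\varphi)$ be a $5$-dimensional Sasakian (spin) manifold and denote by $\nabla$ its unique metric connection with skew-symmetric torsion $\mathrm{T}=\eta\wedge d\eta$ preserving the contact structure. For $s\in\mathbb{R}$ let $\nabla^s$ be the metric connection $$\nabla^s_XY=\nabla^g_XY+2s\,\mathrm{T}(X,Y,-),\qquad \nabla^s_X\psi=\nabla^g_X\psi+s\,(X\lrcorner\,\mathrm{T})\cdot\psi$$ on vector fields and spinor fields, respectively (so that $\nabla=\nabla^{1/4}$). If a connection $\nabla^s$ in this family admits a non-trivial parallel spinor field, then $s=1/4$ and the connection is $\nabla$.
   Context: $\nabla^g$ is the Levi-Civita connection, $X\lrcorner\,\mathrm{T}$ the interior product; forms act on spinors by Clifford multiplication with $X\cdot X=-\|X\|^2$. $\xi$ is the unit Killing (Reeb) vector field, $\eta$ the dual contact form; the normalization is such that $2\nabla^g_X\xi=X\lrcorner\, d\eta$ and, in an adapted local orthonormal frame $e_1,\dots,e_5$ with $e_5=\xi$, $d\eta=2(e_{1}\wedge e_2+e_{3}\wedge e_4)$. It is known that there is a unique metric connection with totally skew-symmetric torsion preserving the Sasakian structure $(g,\xi,\eta,\varphi)$, and that its torsion form is $\eta\wedge d\eta$. (For a connection $\nabla_XY=\nabla^g_XY+\frac12\mathrm{T}(X,Y,-)$ the torsion form is $\mathrm{T}$.) *)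

(* Defs.v *)
From HB Require Import structures.
From mathcomp Require Import all_boot all_order all_algebra.
From mathcomp Require Import complex.
From mathcomp Require Import all_classical all_reals all_analysis.

Set Implicit Arguments.
Unset Strict Implicit.
Unset Printing Implicit Defensive.

Import Order.TTheory GRing.Theory Num.Theory.
Import numFieldNormedType.Exports.

Local Open Scope classical_set_scope.
Local Open Scope ring_scope.
Local Open Scope complex_scope.

(** * Smooth 5-manifolds *)

Section Manifold.
Context (R : realType).
Local Notation E := 'rV[R]_5.

(* C^k on an open set U of R^5: all partial derivatives of order at most k
   exist and are continuous on U; the values of f outside U are irrelevant. *)
Fixpoint Ck_on (k : nat) (U : set E) (f : E -> R) : Prop :=
  (forall x, U x -> {for x, continuous f}) /\
  if k is k'.+1 then
    forall i : 'I_5, (forall x, U x -> derivable f x (delta_mx 0 i)) /\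
                     Ck_on k' U (fun x => 'D_(delta_mx 0 i) f x)
  else True.

Definition Cinf_on (U : set E) (f : E -> R) : Prop := forall k, Ck_on k U f.

(* A chart is a homeomorphism of an open set chart_dom onto an open subset of
   R^5; chart_map and chart_inv are total, with arbitrary values elsewhere. *)
Record chart (M : topologicalType) := Chart {
  chart_dom : set M;
  chart_map : M -> E;
  chart_inv : E -> M;
  chart_dom_open : open chart_dom;
  chart_img_open : open (chart_map @` chart_dom);
  chart_mapK : forall p, chart_dom p -> chart_inv (chart_map p) = p;
  chart_map_cont : forall p, chart_dom p -> {for p, continuous chart_map};
  chart_inv_cont : forall x, (chart_map @` chart_dom) x ->
    {for x, continuous chart_inv}
}.

Record manifold5 := Manifold5 {
  carrier :> topologicalType;
  manifold_hausdorff : hausdorff_space carrier;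
  manifold_second_countable : @second_countable carrier;
  atlas : set (chart carrier);
  atlas_cover : forall p, exists2 c, atlas c & chart_dom c p;
  atlas_smooth : forall c c', atlas c -> atlas c' -> forall i : 'I_5,
    Cinf_on (chart_map c @` (chart_dom c `&` chart_dom c'))
            (fun x => chart_map c' (chart_inv c x) 0 i)
}.

Context (M : manifold5).

Definition smooth_on (U : set M) (f : M -> R) : Prop :=
  forall c, atlas c ->
    Cinf_on (chart_map c @` (U `&` chart_dom c)) (f \o chart_inv c).

Definition smooth_at (p : M) (f : M -> R) : Prop :=
  exists U : set M, [/\ open U, U p & smooth_on U f].

(** Tangent vectors are derivations at p of the germs of smooth functions.
    They are represented by functionals on all functions M -> R which depend
    only on the germ at p; the value 0 on functions that are not smooth near p
    is imposed so that each derivation has exactly one representative. *)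
Definition is_tangent (p : M) (v : (M -> R) -> R) : Prop :=
  [/\ forall f, ~ smooth_at p f -> v f = 0,
      forall f g, (\forall q \near p, f q = g q) -> v f = v g,
      forall (a : R) f g, smooth_at p f -> smooth_at p g ->
        v (fun q => a * f q + g q) = a * v f + v g
    & forall f g, smooth_at p f -> smooth_at p g ->
        v (fun q => f q * g q) = f p * v g + g p * v f].

Definition tangent_pred (p : M) : {pred ((M -> R) -> R)} :=
  fun v => `[< is_tangent p v >].

Lemma tangent_pred_closed p : GRing.subsemimod_closed (tangent_pred p).
Proof.
split; first split.
- apply/asboolP; split => //.
  + by move=> a f g _ _; rewrite /= mulr0 addr0.
  + by move=> f g _ _; rewrite /= !mulr0 addr0.
- move=> u v /asboolP[u0 ug uD uM] /asboolP[v0 vg vD vM].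
  apply/asboolP; split.
  + by move=> f nf; change (u f + v f = 0); rewrite u0 // v0 // addr0.
  + by move=> f g fg; change (u f + v f = u g + v g); rewrite (ug _ _ fg) (vg _ _ fg).
  + move=> a f g sf sg.
    change (u (fun q => a * f q + g q) + v (fun q => a * f q + g q) =
            a * (u f + v f) + (u g + v g)).
    by rewrite uD // vD // mulrDr addrACA.
  + move=> f g sf sg.
    change (u (fun q => f q * g q) + v (fun q => f q * g q) =
            f p * (u g + v g) + g p * (u f + v f)).
    by rewrite uM // vM // !mulrDr addrACA.
- move=> b v /asboolP[v0 vg vD vM]; apply/asboolP; split.
  + by move=> f nf; change (b * v f = 0); rewrite v0 // mulr0.
  + by move=> f g fg; change (b * v f = b * v g); rewrite (vg _ _ fg).
  + move=> a f g sf sg.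
    change (b * v (fun q => a * f q + g q) = a * (b * v f) + b * v g).
    by rewrite vD // mulrDr mulrCA.
  + move=> f g sf sg.
    change (b * v (fun q => f q * g q) = f p * (b * v g) + g p * (b * v f)).
    by rewrite vM // mulrDr !(mulrCA b).
Qed.

HB.instance Definition _ p :=
  GRing.isSubmodClosed.Build R ((M -> R) -> R) (tangent_pred p)
    (tangent_pred_closed p).

Record tangent (p : M) := Tangent {
  tangent_fun :> (M -> R) -> R;
  tangent_funP : tangent_fun \in tangent_pred p
}.

HB.instance Definition _ p := [isSub for @tangent_fun p].
HB.instance Definition _ p := [Choice of tangent p by <:].
HB.instance Definition _ p := [SubChoice_isSubZmodule of tangent p by <:].
HB.instance Definition _ p := [SubZmodule_isSubLmodule of tangent p by <:].

(** * Vector fields *)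

(* Sections of TM without regularity; local fields on U are total sections
   whose values outside U are irrelevant. *)
Definition vfield := forall p : M, tangent p.

Definition smooth_vf (U : set M) (X : vfield) : Prop :=
  forall (V : set M) (f : M -> R), open V -> V `<=` U -> smooth_on V f ->
    smooth_on V (fun q => X q f).

(* [X, Y]_p : the tangent vector f |-> X_p(Y f) - Y_p(X f), which exists (and is
   unique) when X and Y are smooth near p. *)
Definition lie_bracket (X Y : vfield) : vfield := fun p =>
  xget 0 [set w : tangent p | forall f, smooth_at p f ->
    w f = X p (fun q => Y q f) - Y p (fun q => X q f)].

(** * Riemannian metrics and connections *)

Record metric := Metric {
  met :> forall p : M, tangent p -> tangent p -> R;
  met_sym : forall p (u v : tangent p), met u v = met v u;
  met_linear : forall p (a : R) (u u' v : tangent p),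
    met (a *: u + u') v = a * met u v + met u' v;
  met_pos : forall p (u : tangent p), u != 0 -> 0 < met u u;
  met_smooth : forall U X Y, open U -> smooth_vf U X -> smooth_vf U Y ->
    smooth_on U (fun q => met (X q) (Y q))
}.

(* conn p v Y is the covariant derivative of Y at p in the direction v. *)
Record connection := Connection {
  conn :> forall p : M, tangent p -> vfield -> tangent p;
  conn_local : forall p (v : tangent p) (Y Z : vfield),
    (\forall q \near p, Y q = Z q) ->
    conn v Y = conn v Z;
  conn_linear : forall p (a : R) (u v : tangent p) Y,
    conn (a *: u + v) Y = a *: conn u Y + conn v Y;
  conn_add : forall U p (v : tangent p) (Y Z : vfield), open U -> U p ->
    smooth_vf U Y -> smooth_vf U Z ->
    conn v (fun q => Y q + Z q) = conn v Y + conn v Z;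
  conn_leibniz : forall U p (v : tangent p) (f : M -> R) (Y : vfield), open U -> U p ->
    smooth_on U f -> smooth_vf U Y ->
    conn v (fun q => f q *: Y q) = v f *: Y p + f p *: conn v Y;
  conn_smooth : forall U (X Y : vfield), open U ->
    smooth_vf U X -> smooth_vf U Y -> smooth_vf U (fun q => conn (X q) Y)
}.

Definition metric_connection (g : metric) (D : connection) : Prop :=
  forall U p (v : tangent p) Y Z, open U -> U p -> smooth_vf U Y -> smooth_vf U Z ->
    v (fun q => g q (Y q) (Z q)) = g p (D p v Y) (Z p) + g p (Y p) (D p v Z).

Definition torsion (D : connection) (X Y : vfield) : vfield := fun p =>
  D p (X p) Y - D p (Y p) X - lie_bracket X Y p.

Definition levi_civita (g : metric) (D : connection) : Prop :=
  metric_connection g D /\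
  forall U p X Y, open U -> U p -> smooth_vf U X -> smooth_vf U Y ->
    torsion D X Y p = 0.

(** * Differential forms

    Forms of degree 2 and 3 are given by their values on vector fields. *)

Definition ext_d (eta : forall p : M, tangent p -> R) (X Y : vfield) (p : M) : R :=
  X p (fun q => eta q (Y q)) - Y p (fun q => eta q (X q))
  - eta p (lie_bracket X Y p).

Definition wedge12 (eta : forall p : M, tangent p -> R)
    (om : vfield -> vfield -> M -> R) (X Y Z : vfield) (p : M) : R :=
  eta p (X p) * om Y Z p + eta p (Y p) * om Z X p + eta p (Z p) * om X Y p.

(** * Sasakian structures: normal contact metric structures *)

Record sasakian (g : metric) := Sasakian {
  reeb : vfield;
  ctform : forall p : M, tangent p -> R;
  phi : forall p : M, tangent p -> tangent p;
  reeb_smooth : smooth_vf setT reeb;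
  ctform_linear : forall p (a : R) u v,
    ctform (a *: u + v) = a * ctform u + @ctform p v;
  ctform_smooth : forall U X, open U -> smooth_vf U X ->
    smooth_on U (fun q => ctform (X q));
  phi_linear : forall p (a : R) u v, phi (a *: u + v) = a *: phi u + @phi p v;
  phi_smooth : forall U X, open U -> smooth_vf U X ->
    smooth_vf U (fun q => phi (X q));
  (* almost contact metric structure *)
  ctform_reeb : forall p, ctform (reeb p) = 1;
  phi_phi : forall p (u : tangent p), phi (phi u) = - u + ctform u *: reeb p;
  phi_met : forall p (u v : tangent p), g p (phi u) (phi v) = g p u v - ctform u * ctform v;
  (* contact metric structure: d eta = 2 F, with F(X,Y) = g(X, phi Y) *)
  contact_metric : forall U p X Y, open U -> U p ->
    smooth_vf U X -> smooth_vf U Y ->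
    ext_d ctform X Y p = 2 * g p (X p) (phi (Y p));
  (* normality: the Nijenhuis tensor [phi, phi] + d eta (x) xi vanishes *)
  normality : forall U p X Y, open U -> U p ->
    smooth_vf U X -> smooth_vf U Y ->
    let phif (Z : vfield) : vfield := fun q => phi (Z q) in
    lie_bracket (phif X) (phif Y) p + phi (phi (lie_bracket X Y p))
    - phi (lie_bracket (phif X) Y p) - phi (lie_bracket X (phif Y) p)
    + ext_d ctform X Y p *: reeb p = 0
}.

Section Family.
Context (g : metric) (S : sasakian g).

(* T = eta /\ d eta *)
Definition sasT : vfield -> vfield -> vfield -> M -> R :=
  wedge12 (ctform S) (ext_d (ctform S)).

(* D is a metric connection with skew-symmetric torsion form T = eta /\ d eta
   which preserves xi, eta and phi. *)
Definition characteristic_connection (D : connection) : Prop :=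
  [/\ metric_connection g D,
      forall U p X Y Z, open U -> U p ->
        smooth_vf U X -> smooth_vf U Y -> smooth_vf U Z ->
        g p (torsion D X Y p) (Z p) = sasT X Y Z p,
      forall p (v : tangent p), D p v (reeb S) = 0,
      forall U p (v : tangent p) Y, open U -> U p -> smooth_vf U Y ->
        v (fun q => ctform S (Y q)) = ctform S (D p v Y)
    & forall U p (v : tangent p) Y, open U -> U p -> smooth_vf U Y ->
        D p v (fun q => phi S (Y q)) = phi S (D p v Y)].

(* The vector field metrically dual to the 1-form T(X, Y, -). *)
Definition sasT_vec (X Y : vfield) : vfield := fun p =>
  xget 0 [set w : tangent p | forall U Z, open U -> U p -> smooth_vf U Z ->
    g p w (Z p) = sasT X Y Z p].

Definition nabla_s (Dg : connection) (s : R) (X Y : vfield) : vfield := fun p =>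
  Dg p (X p) Y + (2 * s) *: sasT_vec X Y p.

End Family.

(** * Spin structures and spinors *)

Local Notation C := R[i].

(* Generators of a representation of the complex Clifford algebra of R^5 on the
   spin module C^4, with e_j . e_j = -1. *)
Definition clifford_gen (gam : 'I_5 -> 'M[C]_4) : Prop :=
  forall j k, gam j *m gam k + gam k *m gam j = (- (2 * (j == k)%:R))%:M.

Section Spin.
Context (gam : 'I_5 -> 'M[C]_4).

Definition cliff (u : 'rV[R]_5) : 'M[C]_4 := \sum_j (u 0 j)%:C *: gam j.

(* Spin(5) consists of the products of an even number of unit vectors; its
   representation on C^4 is faithful, so it is taken inside the matrices. *)
Inductive spin5 : 'M[C]_4 -> Prop :=
| spin5_1 : spin5 1%:M
| spin5_mul A (u v : 'rV[R]_5) : spin5 A -> \sum_j u 0 j ^+ 2 = 1 -> \sum_j v 0 j ^+ 2 = 1 ->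
    spin5 (A *m cliff u *m cliff v).

(* Clifford action of the 2-form sum_(j < k) om j k e_j /\ e_k. *)
Definition cliff2 (om : 'I_5 -> 'I_5 -> R) : 'M[C]_4 :=
  \sum_(j < 5) \sum_(k < 5 | (j < k)%N) (om j k)%:C *: (gam j *m gam k).

Definition smoothC_on (U : set M) (f : M -> C) : Prop :=
  smooth_on U (fun q => complex.Re (f q)) /\ smooth_on U (fun q => complex.Im (f q)).

(* A spin structure, given by a trivializing cover of the principal bundle
   Spin -> SO(M): on each dom i a section of Spin lying over the orthonormal
   frame (frame i), and on each overlap the Spin(5)-valued function
   (trans i j) by which the j-th section is the i-th section times trans i j.
   frame_trans says that trans i j lies over the change of frames, i.e.
   h . e_b . h^-1 = sum_a L_(ab) e_a where frame j b = sum_a L_(ab) frame i a. *)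
Record spin_structure (g : metric) := SpinStructure {
  idx : Type;
  dom : idx -> set M;
  frame : idx -> 'I_5 -> vfield;
  trans : idx -> idx -> M -> 'M[C]_4;
  dom_open : forall i, open (dom i);
  dom_cover : forall p, exists i, dom i p;
  frame_smooth : forall i a, smooth_vf (dom i) (frame i a);
  frame_orthonormal : forall i p, dom i p -> forall a b,
    g p (frame i a p) (frame i b p) = (a == b)%:R;
  frame_basis : forall i p, dom i p -> forall v : tangent p,
    exists c : 'I_5 -> R, v = \sum_a c a *: frame i a p;
  trans_spin : forall i j p, dom i p -> dom j p -> spin5 (trans i j p);
  trans_smooth : forall i j a b,
    smoothC_on (dom i `&` dom j) (fun q => trans i j q a b);
  trans_cocycle : forall i j k p, dom i p -> dom j p -> dom k p ->
    trans i k p = trans i j p *m trans j k p;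
  frame_trans : forall i j p, dom i p -> dom j p -> forall b,
    trans i j p *m gam b =
    (\sum_a (g p (frame i a p) (frame j b p))%:C *: gam a) *m trans i j p
}.

Context (g : metric) (P : spin_structure g).

(* A smooth section of the spinor bundle P x_Spin(5) C^4: its C^4-valued
   component psi i in the i-th trivialization, for each i. *)
Record spinor_field := SpinorField {
  spn :> idx P -> M -> 'cV[C]_4;
  spn_smooth : forall i a, smoothC_on (dom i) (fun q => spn i q a 0);
  spn_trans : forall i j p, dom i p -> dom j p ->
    spn i p = trans i j p *m spn j p
}.

Definition spinor_zero (psi : spinor_field) : Prop :=
  forall i p, dom i p -> psi i p = 0.

Definition dspinor (p : M) (v : tangent p) (f : M -> 'cV[C]_4) : 'cV[C]_4 :=
  \col_a (v (fun q => complex.Re (f q a 0)) +i* v (fun q => complex.Im (f q a 0))).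

(* The spinor derivative of the Levi-Civita connection Dg, in the i-th
   trivialization: X(psi) + 1/2 sum_(j < k) g(Dg_X e_j, e_k) e_j . e_k . psi *)
Definition spin_conn (Dg : connection) (psi : spinor_field) (i : idx P)
    (X : vfield) (p : M) : 'cV[C]_4 :=
  dspinor (X p) (psi i) +
  (2^-1)%:C *: (cliff2 (fun j k => g p (Dg p (X p) (frame i j)) (frame i k p))
                *m psi i p).

Definition spin_nabla_s (S : sasakian g) (Dg : connection) (s : R)
    (psi : spinor_field) (i : idx P) (X : vfield) (p : M) : 'cV[C]_4 :=
  spin_conn Dg psi i X p +
  s%:C *: (cliff2 (fun j k => sasT S X (frame i j) (frame i k) p) *m psi i p).

Definition parallel_spinor (S : sasakian g) (Dg : connection) (s : R)
    (psi : spinor_field) : Prop :=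
  forall i U p X, open U -> U `<=` dom i -> U p -> smooth_vf U X ->
    spin_nabla_s S Dg s psi i X p = 0.

End Spin.
End Manifold.

(* Main.v *)
Require Import Defs.
From HB Require Import structures.
From mathcomp Require Import all_boot all_order all_algebra.
From mathcomp Require Import complex.
From mathcomp Require Import all_classical all_reals all_analysis.
From mathcomp Require Import ring lra.
Import Order.TTheory GRing.Theory Num.Theory.
Import numFieldNormedType.Exports.
Local Open Scope classical_set_scope.
Local Open Scope ring_scope.
Local Open Scope complex_scope.
Set Implicit Arguments.
Unset Strict Implicit.
Unset Printing Implicit Defensive.

(** Put u = s - 1/4. The connection D differs from the Levi-Civita connection by
    half of T = eta /\ d eta, so nabla^(1/4) = D on vector fields, and on spinors
    nabla^s_X psi = D_X psi + u (X _| T) . psi. Suppose that psi is parallel for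
    nabla^s and that u <> 0; the claim is that psi = 0.

    The spin module carries a complex symplectic form B which is invariant under
    Spin(5) and for which every vector is self-adjoint. For an element A of the
    Clifford algebra write beta(A) = B(psi, A psi); thus beta vanishes on scalars.
    Let Omega be Clifford multiplication by d eta. It is D-parallel, and
    f = beta(Omega) is an ordinary complex function on M. The derivative of f is
    purely algebraic in psi:
      v f = u beta([v _| T, Omega]) = - 8 u beta(xi v).
    Differentiating once more along a horizontal field X, for horizontal Y,
      X(Y f) = - 8 u (beta(xi (D_X Y)) + 2 u beta([phi X, Y])).
    The two fields satisfy X(Y f) - Y(X f) = [X, Y] f and
    D_X Y - D_Y X - [X, Y] is a multiple of xi, so that all terms with
    derivatives of X and Y cancel and u^2 (beta([phi X, Y]) - beta([phi Y, X])) = 0.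
    The curvature of D never enters.

    The rest is linear algebra in the spin module. In a basis adapted to the
    eigenvalues (-4i, 0, 0, 4i) of Omega, with coordinates x0, ..., x3 of psi, the
    last equation says that x0^2 + x3^2 = x0^2 - x3^2 = 0, whereas f is a multiple
    of x0 x3. Hence f vanishes identically. But then so do beta(xi v) and, by the
    formula for X(Y f), all beta([phi X, Y]); these include the sums and
    differences of the squares of all four coordinates, and psi = 0.

    The two steps of linear algebra are beta_Omega_eq0 and psi_eq0, the two
    derivatives are derC_Omega_pairing and derC_reeb_pairing. *)

(** * Smooth functions and tangent vectors *)

Section CkCalculus.
Context (R : realType).
Local Notation E := 'rV[R]_5.

Lemma open_near (T : topologicalType) (U : set T) (x : T) (P : T -> Prop) :
  open U -> U x -> (forall y, U y -> P y) -> \forall y \near x, P y.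
Proof. by move=> oU Ux UP; apply: filterS UP (open_nbhs_nbhs _). Qed.

(** Membership in C^k of an open set ignores the values elsewhere; this lets the
    product rule, valid only inside U, be used under Ck_on. *)
Lemma Ck_on_ext k (U : set E) (f g : E -> R) : open U ->
  (forall x, U x -> f x = g x) -> Ck_on k U f -> Ck_on k U g.
Proof.
elim: k f g => [|k IH] f g oU fg /= [cf df]; (split => [x Ux|]).
- have e := open_near oU Ux fg.
  have ec : g y @[y --> x] --> f x.
    exact: (cvg_trans (near_eq_cvg e) (cf _ Ux)).
  by rewrite /prop_for /continuous_at -(fg _ Ux).
- by [].
- have e := open_near oU Ux fg.
  have ec : g y @[y --> x] --> f x.
    exact: (cvg_trans (near_eq_cvg e) (cf _ Ux)).
  by rewrite /prop_for /continuous_at -(fg _ Ux).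
- move=> i; have [dfi Cfi] := df i; split => [x Ux|].
    by apply: (@near_eq_derivable _ _ _ f); [exact: open_near oU Ux fg | exact: dfi].
  apply: IH Cfi => // x Ux.
  by apply: near_eq_derive; exact: open_near oU Ux fg.
Qed.

Lemma Ck_on_sub k (U V : set E) (f : E -> R) : V `<=` U -> Ck_on k U f -> Ck_on k V f.
Proof.
move=> VU; elim: k f => [|k IH] f /= [cf df].
  by split => // x /VU/cf.
split => [x /VU/cf //|i].
by have [a b] := df i; split; [move=> x /VU/a | exact: IH].
Qed.

Lemma Ck_on_pred k (U : set E) (f : E -> R) : Ck_on k.+1 U f -> Ck_on k U f.
Proof.
elim: k f => [|k IH] f [cf df]; split => // i.
by have [a b] := df i; split => //; exact: IH.
Qed.

Lemma Ck_on_cst k (U : set E) (a : R) : Ck_on k U (fun=> a).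
Proof.
elim: k a => [|k IH] a /=; first by split => // x _; exact: cst_continuous.
split => [x _|i]; first exact: cst_continuous.
split => [x _|]; first exact: derivable_cst.
have -> // : (fun x : E => 'D_(delta_mx 0 i) (fun=> a) x) = (fun=> 0 : R).
by apply/funext => x; exact: derive_cst.
Qed.

Lemma Ck_onD k (U : set E) (f g : E -> R) : open U ->
  Ck_on k U f -> Ck_on k U g -> Ck_on k U (fun x => f x + g x).
Proof.
move=> oU; elim: k f g => [|k IH] f g /= [cf df] [cg dg].
  by split=> // x Ux; exact: (cvgD (cf x Ux) (cg x Ux)).
split=> [x Ux|i]; first by exact: (cvgD (cf x Ux) (cg x Ux)).
have [df1 df2] := df i; have [dg1 dg2] := dg i.
split=> [x Ux|]; first exact: (@derivableD _ _ _ f g x _ (df1 x Ux) (dg1 x Ux)).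
apply: Ck_on_ext (IH _ _ df2 dg2) => // x Ux.
by rewrite -(@deriveD _ _ _ f g x _ (df1 x Ux) (dg1 x Ux)).
Qed.

Lemma Ck_onM k (U : set E) (f g : E -> R) : open U ->
  Ck_on k U f -> Ck_on k U g -> Ck_on k U (fun x => f x * g x).
Proof.
move=> oU; elim: k f g => [|k IH] f g.
  by move=> [cf df] [cg dg]; split=> // x Ux; exact: (cvgM (cf x Ux) (cg x Ux)).
move=> Cf Cg; have Cf' := Ck_on_pred Cf; have Cg' := Ck_on_pred Cg.
case: Cf Cg => [cf df] [cg dg].
split=> [x Ux|i]; first by exact: (cvgM (cf x Ux) (cg x Ux)).
have [df1 df2] := df i; have [dg1 dg2] := dg i.
split=> [x Ux|]; first exact: (@derivableM _ _ f g x _ (df1 x Ux) (dg1 x Ux)).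
apply: (@Ck_on_ext _ _ (fun x => f x * 'D_(delta_mx 0 i) g x + g x * 'D_(delta_mx 0 i) f x)) => //.
  by move=> x Ux; exact: (esym (@deriveM _ _ f g x _ (df1 x Ux) (dg1 x Ux))).
by apply: Ck_onD => //; exact: IH.
Qed.

End CkCalculus.

Section Smooth.
Context (R : realType) (M : manifold5 R).
Implicit Types (U V : set M) (p : M) (f h : M -> R).

(** The chart is open on its domain because chart_inv is continuous on the
    image, which is itself open. *)
Lemma chart_image_open (c : chart R M) U : open U ->
  open (chart_map c @` (U `&` chart_dom c)).
Proof.
move=> oU; rewrite openE => _ [p [Up cp] <-].
have ic : (chart_map c @` chart_dom c) (chart_map c p) by exists p.
have oU' : open (U `&` chart_dom c) by apply: openI => //; exact: chart_dom_open.
have n1 : nbhs (chart_map c p) (chart_map c @` chart_dom c).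
  by apply: open_nbhs_nbhs; split => //; exact: chart_img_open.
have n2 : nbhs (chart_map c p) (chart_inv c @^-1` (U `&` chart_dom c)).
  apply: (chart_inv_cont ic); rewrite chart_mapK //.
  exact: open_nbhs_nbhs.
apply: filterS (filterI n1 n2) => x [[q cq <-]] [] /=; rewrite chart_mapK // => Uq _.
by exists q.
Qed.

Lemma smooth_on_sub U V f : V `<=` U -> smooth_on U f -> smooth_on V f.
Proof.
move=> VU sf c ac k; apply: Ck_on_sub (sf c ac k) => x [q [Vq cq] <-].
by exists q => //; split => //; exact: VU.
Qed.

Lemma smooth_on_ext U f h : open U -> (forall q, U q -> f q = h q) ->
  smooth_on U f -> smooth_on U h.
Proof.
move=> oU fh sf c ac k; apply: Ck_on_ext (sf c ac k); first exact: chart_image_open.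
by move=> _ [q [Uq cq] <-] /=; rewrite chart_mapK // fh.
Qed.

Lemma smooth_on_cst U (a : R) : smooth_on U (fun=> a).
Proof. by move=> c ac k; exact: Ck_on_cst. Qed.

Lemma smooth_onD U f h : open U -> smooth_on U f -> smooth_on U h ->
  smooth_on U (fun q => f q + h q).
Proof. by move=> oU sf sh c ac k; apply: Ck_onD (sf c ac k) (sh c ac k); exact: chart_image_open. Qed.

Lemma smooth_onM U f h : open U -> smooth_on U f -> smooth_on U h ->
  smooth_on U (fun q => f q * h q).
Proof. by move=> oU sf sh c ac k; apply: Ck_onM (sf c ac k) (sh c ac k); exact: chart_image_open. Qed.

Lemma smooth_at2 p f h : smooth_at p f -> smooth_at p h ->
  exists U, [/\ open U, U p, smooth_on U f & smooth_on U h].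
Proof.
move=> [U [oU Up sf]] [V [oV Vp sh]]; exists (U `&` V); split => //.
- exact: openI.
- by apply: smooth_on_sub sf => ? [].
- by apply: smooth_on_sub sh => ? [].
Qed.

Lemma smooth_at_cst p (a : R) : smooth_at p (fun=> a).
Proof. by exists setT; split => //; [exact: openT | exact: smooth_on_cst]. Qed.

Lemma smooth_atD p f h : smooth_at p f -> smooth_at p h -> smooth_at p (fun q => f q + h q).
Proof. by move=> sf /(smooth_at2 sf) [U [oU Up a b]]; exists U; split => //; exact: smooth_onD. Qed.

Lemma smooth_atM p f h : smooth_at p f -> smooth_at p h -> smooth_at p (fun q => f q * h q).
Proof. by move=> sf /(smooth_at2 sf) [U [oU Up a b]]; exists U; split => //; exact: smooth_onM. Qed.

Lemma smooth_atB p f h : smooth_at p f -> smooth_at p h -> smooth_at p (fun q => f q - h q).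
Proof.
move=> sf sh; apply: smooth_atD => //.
have := smooth_atM (smooth_at_cst p (-1)) sh.
by congr smooth_at; apply/funext => q; rewrite mulN1r.
Qed.

Lemma smooth_at_near p f : smooth_at p f -> \forall q \near p, smooth_at q f.
Proof. by move=> [U [oU Up sf]]; apply: (open_near oU Up) => q Uq; exists U. Qed.

Lemma smooth_at_near_eq p f h : (\forall q \near p, f q = h q) ->
  smooth_at p f -> smooth_at p h.
Proof.
move=> e [V [oV Vp sV]].
have [W [oW Wp] We] : exists2 W, open_nbhs p W & W `<=` [set q | f q = h q].
  by have : nbhs p [set q | f q = h q] by []; rewrite nbhsE.
exists (V `&` W); split => //; first exact: openI.
apply: (@smooth_on_ext _ f); first exact: openI.
  by move=> q [_ /We].
by apply: smooth_on_sub sV => ? [].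
Qed.

Section Derivation.
Context (p : M) (v : tangent p).

Lemma tangentP : is_tangent p v.
Proof. exact: asboolW (tangent_funP v). Qed.

Lemma tan_near f h : (\forall q \near p, f q = h q) -> v f = v h.
Proof. by case: tangentP => _ + _ _; exact. Qed.

Lemma tan_lin (a : R) f h : smooth_at p f -> smooth_at p h ->
  v (fun q => a * f q + h q) = a * v f + v h.
Proof. by case: tangentP => _ _ + _; exact. Qed.

Lemma tanM f h : smooth_at p f -> smooth_at p h ->
  v (fun q => f q * h q) = f p * v h + h p * v f.
Proof. by case: tangentP => _ _ _; exact. Qed.

Lemma tan_cst (a : R) : v (fun=> a) = 0.
Proof.
have v1 : v (fun=> 1) = 0.
  have := tanM (smooth_at_cst p 1) (smooth_at_cst p 1); rewrite mulr1 !mul1r => e.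
  by apply: (addrI (v (fun=> 1))); rewrite addr0 -e.
have := tan_lin (a - 1) (smooth_at_cst p 1) (smooth_at_cst p 1).
by rewrite v1 mulr0 addr0 mulr1 subrK.
Qed.

Lemma tanD f h : smooth_at p f -> smooth_at p h -> v (fun q => f q + h q) = v f + v h.
Proof.
move=> sf sh; rewrite -[v f]mul1r -tan_lin //.
by congr (v _); apply/funext => q; rewrite mul1r.
Qed.

Lemma tanB f h : smooth_at p f -> smooth_at p h -> v (fun q => f q - h q) = v f - v h.
Proof.
move=> sf sh; rewrite addrC -mulN1r -tan_lin //.
by congr (v _); apply/funext => q; rewrite mulN1r addrC.
Qed.

End Derivation.

Lemma tangentDE p (u v : tangent p) f : (u + v) f = u f + v f.
Proof. by []. Qed.

Lemma smooth_vf_sub U V (X : vfield M) : V `<=` U -> smooth_vf U X -> smooth_vf V X.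
Proof. by move=> VU sX W f oW WV; apply: sX => // q /WV/VU. Qed.

Lemma smooth_at_vf U p (X : vfield M) f : open U -> U p -> smooth_vf U X ->
  smooth_at p f -> smooth_at p (fun q => X q f).
Proof.
move=> oU Up sX [V [oV Vp sf]]; exists (U `&` V); split => //; first exact: openI.
apply: sX => //; first exact: openI.
by apply: smooth_on_sub sf => ? [].
Qed.

(** The bracket is defined by choice, so its existence has to be shown: the
    commutator X Y - Y X, cut off to 0 on functions that are not smooth at p, is
    a derivation because the second-order terms cancel. *)
Lemma lie_bracketE U p (X Y : vfield M) f : open U -> U p ->
  smooth_vf U X -> smooth_vf U Y -> smooth_at p f ->
  lie_bracket X Y p f = X p (fun q => Y q f) - Y p (fun q => X q f).
Proof.
move=> oU Up sX sY sf.
set c := fun h : M -> R => X p (fun q => Y q h) - Y p (fun q => X q h).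
pose w (h : M -> R) := if `[< smooth_at p h >] then c h else 0.
have wE h : smooth_at p h -> w h = c h by move=> sh; rewrite /w asboolT.
have nearD (Z : vfield M) (h1 h2 : M -> R) :
    (\forall q \near p, h1 q = h2 q) -> \forall q \near p, Z q h1 = Z q h2.
  by move=> e; apply: filterS (near_join e) => q; exact: tan_near.
have cE h1 h2 : (\forall q \near p, h1 q = h2 q) -> c h1 = c h2.
  by move=> e; rewrite /c (tan_near (X p) (nearD Y _ _ e)) (tan_near (Y p) (nearD X _ _ e)).
have sX1 h : smooth_at p h -> smooth_at p (fun q => X q h) by exact: (smooth_at_vf oU Up sX).
have sY1 h : smooth_at p h -> smooth_at p (fun q => Y q h) by exact: (smooth_at_vf oU Up sY).
have tw : is_tangent p w.
  split.
  - by move=> h nh; rewrite /w asboolF.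
  - move=> h1 h2 e; rewrite /w (cE _ _ e).
    have -> // : `[< smooth_at p h1 >] = `[< smooth_at p h2 >].
    by apply: asbool_equiv_eq; split; apply: smooth_at_near_eq; apply: filterS e.
  - move=> a h1 h2 s1 s2; rewrite !wE //; last first.
      by apply: smooth_atD => //; apply: smooth_atM => //; exact: smooth_at_cst.
    have lin (Z Z' : vfield M) : (forall h, smooth_at p h -> smooth_at p (fun q => Z q h)) ->
       Z' p (fun q => Z q (fun r => a * h1 r + h2 r)) =
       a * Z' p (fun q => Z q h1) + Z' p (fun q => Z q h2).
      move=> sZ; rewrite -tan_lin //; try exact: sZ; apply: tan_near.
      near=> q; apply: tan_lin.
        by near: q; exact: smooth_at_near.
      by near: q; exact: smooth_at_near.
    by rewrite /c !lin // mulrBr opprD addrACA.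
  - move=> h1 h2 s1 s2; rewrite !wE //; last exact: smooth_atM.
    have lei (Z Z' : vfield M) : (forall h, smooth_at p h -> smooth_at p (fun q => Z q h)) ->
       Z' p (fun q => Z q (fun r => h1 r * h2 r)) =
       h1 p * Z' p (fun q => Z q h2) + Z p h2 * Z' p h1 +
       (h2 p * Z' p (fun q => Z q h1) + Z p h1 * Z' p h2).
      move=> sZ; rewrite -!tanM -?tanD //; try exact: sZ; last first.
      - by apply: smooth_atM => //; exact: sZ.
      - by apply: smooth_atM => //; exact: sZ.
      apply: tan_near; near=> q; apply: tanM.
        by near: q; exact: smooth_at_near.
      by near: q; exact: smooth_at_near.
    by rewrite /c !lei //; ring.
have wt : w \in tangent_pred p by apply/asboolP.
have := @xgetPex _ (0 : tangent p) [set w : tangent p | forall f, smooth_at p f ->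
    w f = X p (fun q => Y q f) - Y p (fun q => X q f)].
apply => //; exists (Tangent wt) => h sh /=; exact: wE.
Unshelve. all: by end_near. Qed.

End Smooth.

(** * Derivatives of matrix-valued functions *)

Section ComplexMatrix.
Context (R : realType) (M : manifold5 R).
Local Notation C := R[i].
Implicit Types (p : M).

Definition smoothC_at p (F : M -> C) : Prop :=
  smooth_at p (fun q => complex.Re (F q)) /\ smooth_at p (fun q => complex.Im (F q)).

Definition smoothM_at m n p (F : M -> 'M[C]_(m, n)) : Prop :=
  forall i j, smoothC_at p (fun q => F q i j).

Definition derC p (v : tangent p) (F : M -> C) : C :=
  v (fun q => complex.Re (F q)) +i* v (fun q => complex.Im (F q)).

Definition derM m n p (v : tangent p) (F : M -> 'M[C]_(m, n)) : 'M[C]_(m, n) :=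
  \matrix_(i, j) derC v (fun q => F q i j).

Lemma smoothC_at_cst p (a : C) : smoothC_at p (fun=> a).
Proof. by split; exact: smooth_at_cst. Qed.

Lemma smoothC_at_real p (f : M -> R) : smooth_at p f -> smoothC_at p (fun q => (f q)%:C).
Proof. by move=> sf; split => //=; exact: smooth_at_cst. Qed.

Lemma smoothC_atD p F G : smoothC_at p F -> smoothC_at p G ->
  smoothC_at p (fun q => F q + G q).
Proof.
move=> [a b] [c d]; split.
  by rewrite (_ : (fun q => _) = (fun q => complex.Re (F q) + complex.Re (G q)));
    [exact: smooth_atD | apply/funext => q; rewrite raddfD].
by rewrite (_ : (fun q => _) = (fun q => complex.Im (F q) + complex.Im (G q)));
  [exact: smooth_atD | apply/funext => q; rewrite raddfD].
Qed.

Lemma ReM (x y : C) : complex.Re (x * y) =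
  complex.Re x * complex.Re y - complex.Im x * complex.Im y.
Proof. by case: x y => [a b] [c d]. Qed.

Lemma ImM (x y : C) : complex.Im (x * y) =
  complex.Re x * complex.Im y + complex.Im x * complex.Re y.
Proof. by case: x y => [a b] [c d]. Qed.

Lemma smoothC_atM p F G : smoothC_at p F -> smoothC_at p G ->
  smoothC_at p (fun q => F q * G q).
Proof.
move=> [a b] [c d]; split.
  rewrite (_ : (fun q => _) = (fun q => complex.Re (F q) * complex.Re (G q) -
      complex.Im (F q) * complex.Im (G q))); last by apply/funext => q; rewrite ReM.
  by apply: smooth_atB; exact: smooth_atM.
rewrite (_ : (fun q => _) = (fun q => complex.Re (F q) * complex.Im (G q) +
    complex.Im (F q) * complex.Re (G q))); last by apply/funext => q; rewrite ImM.
by apply: smooth_atD; exact: smooth_atM.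
Qed.

Lemma derC_near p (v : tangent p) F G : (\forall q \near p, F q = G q) ->
  derC v F = derC v G.
Proof.
by move=> e; congr (_ +i* _); apply: tan_near; apply: filterS e => q ->.
Qed.

Lemma derC_cst p (v : tangent p) a : derC v (fun=> a) = 0.
Proof. by rewrite /derC !tan_cst. Qed.

Lemma derC_real p (v : tangent p) (f : M -> R) : derC v (fun q => (f q)%:C) = (v f)%:C.
Proof. by rewrite /derC tan_cst. Qed.

Lemma derCD p (v : tangent p) F G : smoothC_at p F -> smoothC_at p G ->
  derC v (fun q => F q + G q) = derC v F + derC v G.
Proof.
move=> [a b] [c d]; apply/eqP; rewrite eq_complex /=; apply/andP; split; apply/eqP.
  by rewrite -tanD //; congr (v _); apply/funext => q; rewrite raddfD.
by rewrite -tanD //; congr (v _); apply/funext => q; rewrite raddfD.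
Qed.

Lemma derCM p (v : tangent p) F G : smoothC_at p F -> smoothC_at p G ->
  derC v (fun q => F q * G q) = derC v F * G p + F p * derC v G.
Proof.
move=> [a b] [c d].
apply/eqP; rewrite eq_complex !raddfD /= !ReM !ImM /=; apply/andP; split; apply/eqP.
  rewrite (_ : (fun q => _) = (fun q => complex.Re (F q) * complex.Re (G q) -
      complex.Im (F q) * complex.Im (G q))); last by apply/funext => q; rewrite ReM.
  by rewrite tanB ?tanM //; [ring | exact: smooth_atM..].
rewrite (_ : (fun q => _) = (fun q => complex.Re (F q) * complex.Im (G q) +
    complex.Im (F q) * complex.Re (G q))); last by apply/funext => q; rewrite ImM.
by rewrite tanD ?tanM //; [ring | exact: smooth_atM..].
Qed.

Lemma derCZ p (v : tangent p) a F : smoothC_at p F ->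
  derC v (fun q => a * F q) = a * derC v F.
Proof. by move=> sF; rewrite derCM ?derC_cst ?mul0r ?add0r //; exact: smoothC_at_cst. Qed.

Lemma derC_sum p (v : tangent p) (I : Type) (r : seq I) (F : I -> M -> C) :
  (forall i, smoothC_at p (F i)) ->
  smoothC_at p (fun q => \sum_(i <- r) F i q) /\
  derC v (fun q => \sum_(i <- r) F i q) = \sum_(i <- r) derC v (F i).
Proof.
move=> sF; elim: r => [|i r [IH1 IH2]].
  rewrite big_nil (_ : (fun q => _) = (fun=> 0)); last by apply/funext => q; rewrite big_nil.
  by split; [exact: smoothC_at_cst | exact: derC_cst].
rewrite big_cons (_ : (fun q => _) = (fun q => F i q + \sum_(j <- r) F j q)); last first.
  by apply/funext => q; rewrite big_cons.
by split; [exact: smoothC_atD | rewrite derCD // IH2].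
Qed.

Lemma smoothC_at_sum p (I : Type) (r : seq I) (F : I -> M -> C) :
  (forall i, smoothC_at p (F i)) -> smoothC_at p (fun q => \sum_(i <- r) F i q).
Proof. by move=> sF; have [] := derC_sum (0 : tangent p) r sF. Qed.

Lemma derC_lie_bracket U p (X Y : vfield M) F : open U -> U p ->
  smooth_vf U X -> smooth_vf U Y -> smoothC_at p F ->
  derC (lie_bracket X Y p) F =
  derC (X p) (fun q => derC (Y q) F) - derC (Y p) (fun q => derC (X q) F).
Proof.
move=> oU Up sX sY [sr si].
by rewrite {1}/derC !(lie_bracketE oU Up sX sY).
Qed.

Section Matrix.
Context (p : M) (v : tangent p).

Lemma smoothM_at_cst m n (A : 'M[C]_(m, n)) : smoothM_at p (fun=> A).
Proof. by move=> i j; exact: smoothC_at_cst. Qed.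

Lemma derM_cst m n (A : 'M[C]_(m, n)) : derM v (fun=> A) = 0.
Proof. by apply/matrixP => i j; rewrite !mxE derC_cst. Qed.

Lemma smoothM_atM m n k (F : M -> 'M[C]_(m, n)) (G : M -> 'M[C]_(n, k)) :
  smoothM_at p F -> smoothM_at p G -> smoothM_at p (fun q => F q *m G q).
Proof.
move=> sF sG i j.
rewrite (_ : (fun q => _) = (fun q => \sum_l F q i l * G q l j)); last first.
  by apply/funext => q; rewrite mxE.
by apply: smoothC_at_sum => l; exact: smoothC_atM.
Qed.

Lemma derMM m n k (F : M -> 'M[C]_(m, n)) (G : M -> 'M[C]_(n, k)) :
  smoothM_at p F -> smoothM_at p G ->
  derM v (fun q => F q *m G q) = derM v F *m G p + F p *m derM v G.
Proof.
move=> sF sG; apply/matrixP => i j; rewrite !mxE.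
rewrite (_ : (fun q => _) = (fun q => \sum_l F q i l * G q l j)); last first.
  by apply/funext => q; rewrite mxE.
rewrite (derC_sum v _ (fun l => smoothC_atM (sF i l) (sG l j))).2 -big_split /=.
by apply: eq_bigr => l _; rewrite derCM // !mxE.
Qed.

Lemma smoothM_at_tr m n (F : M -> 'M[C]_(m, n)) :
  smoothM_at p F -> smoothM_at p (fun q => (F q)^T).
Proof.
move=> sF i j; rewrite (_ : (fun q => _) = (fun q => F q j i)) //.
by apply/funext => q; rewrite mxE.
Qed.

Lemma derM_tr m n (F : M -> 'M[C]_(m, n)) : derM v (fun q => (F q)^T) = (derM v F)^T.
Proof.
by apply/matrixP => i j; rewrite !mxE; congr derC; apply/funext => q; rewrite mxE.
Qed.

Lemma smoothM_at_comb m n k (f : 'I_k -> M -> R) (A : 'I_k -> 'M[C]_(m, n)) :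
  (forall a, smooth_at p (f a)) -> smoothM_at p (fun q => \sum_a (f a q)%:C *: A a).
Proof.
move=> sf i j; rewrite (_ : (fun q => _) = (fun q => \sum_a (f a q)%:C * A a i j)).
  by apply: smoothC_at_sum => a; apply: smoothC_atM; [exact: smoothC_at_real | exact: smoothC_at_cst].
by apply/funext => q; rewrite summxE; apply: eq_bigr => a _; rewrite mxE.
Qed.

Lemma derM_comb m n k (f : 'I_k -> M -> R) (A : 'I_k -> 'M[C]_(m, n)) :
  (forall a, smooth_at p (f a)) ->
  derM v (fun q => \sum_a (f a q)%:C *: A a) = \sum_a (v (f a))%:C *: A a.
Proof.
move=> sf; apply/matrixP => i j; rewrite mxE summxE.
rewrite (_ : (fun q => _) = (fun q => \sum_a (f a q)%:C * A a i j)); last first.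
  by apply/funext => q; rewrite summxE; apply: eq_bigr => a _; rewrite mxE.
rewrite (derC_sum v _ (fun a => smoothC_atM (smoothC_at_real (sf a)) (smoothC_at_cst p (A a i j)))).2.
apply: eq_bigr => a _; rewrite derCM ?derC_cst ?mulr0 ?addr0 ?derC_real ?mxE //.
  exact: smoothC_at_real.
exact: smoothC_at_cst.
Qed.

Lemma smoothM_at_sum m n (I : finType) (F : I -> M -> 'M[C]_(m, n)) :
  (forall a, smoothM_at p (F a)) -> smoothM_at p (fun q => \sum_a F a q).
Proof.
move=> sF i j; rewrite (_ : (fun q => _) = (fun q => \sum_a F a q i j)).
  by apply: smoothC_at_sum => a; exact: sF.
by apply/funext => q; rewrite summxE.
Qed.

Lemma derM_sum m n (I : finType) (F : I -> M -> 'M[C]_(m, n)) :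
  (forall a, smoothM_at p (F a)) ->
  derM v (fun q => \sum_a F a q) = \sum_a derM v (F a).
Proof.
move=> sF; apply/matrixP => i j; rewrite mxE summxE.
rewrite (_ : (fun q => _) = (fun q => \sum_a F a q i j)); last first.
  by apply/funext => q; rewrite summxE.
rewrite (derC_sum v _ (fun a => sF a i j)).2.
by apply: eq_bigr => a _; rewrite mxE.
Qed.

End Matrix.
End ComplexMatrix.

(** * The spin module of the complex Clifford algebra *)

Section CliffordRep.
Context (F : fieldType) (i : F).
Hypotheses (ii : i * i = -1) (two : (2 : F) != 0).

Definition mx4 (s : seq (seq F)) : 'M[F]_4 := \matrix_(j, k) nth 0 (nth [::] s j) k.

(** The matrices of g1, ..., g4 in the basis v, g1 v, g3 v, g1 g3 v, where v is a
    common eigenvector of g1 g2 and g3 g4 for the eigenvalue i. *)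
Definition std1 := mx4 [:: [:: 0; -1; 0; 0]; [:: 1; 0; 0; 0]; [:: 0; 0; 0; -1]; [:: 0; 0; 1; 0]].
Definition std2 := mx4 [:: [:: 0; -i; 0; 0]; [:: -i; 0; 0; 0]; [:: 0; 0; 0; -i]; [:: 0; 0; -i; 0]].
Definition std3 := mx4 [:: [:: 0; 0; -1; 0]; [:: 0; 0; 0; 1]; [:: 1; 0; 0; 0]; [:: 0; -1; 0; 0]].
Definition std4 := mx4 [:: [:: 0; 0; -i; 0]; [:: 0; 0; 0; i]; [:: -i; 0; 0; 0]; [:: 0; i; 0; 0]].
(** The invariant symplectic form in that basis. It pairs eigenvectors of g1 g2
    and g3 g4 with opposite eigenvalues, hence the antidiagonal shape. *)
Definition stdB := mx4 [:: [:: 0; 0; 0; 1]; [:: 0; 0; 1; 0]; [:: 0; -1; 0; 0]; [:: -1; 0; 0; 0]].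

Lemma eq_mx4 (A B : 'M[F]_4) :
  (forall j k : 'I_4, A j k = B j k) -> A = B.
Proof. by move=> e; apply/matrixP. Qed.

Lemma forall4 (P : 'I_4 -> Prop) :
  P ord0 -> P (lift ord0 ord0) -> P (lift ord0 (lift ord0 ord0)) -> P (lift ord0 (lift ord0 (lift ord0 ord0))) ->
  forall j, P j.
Proof.
move=> P0 P1 P2 P3 j.
case: (unliftP ord0 j) => [j1 ->|->] //; case: (unliftP ord0 j1) => [j2 ->|->] //.
case: (unliftP ord0 j2) => [j3 ->|->] //.
by rewrite (ord1 j3).
Qed.

Lemma sum4 (f : 'I_4 -> F) : \sum_j f j =
  f ord0 + f (lift ord0 ord0) + f (lift ord0 (lift ord0 ord0)) + f (lift ord0 (lift ord0 (lift ord0 ord0))).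
Proof. by rewrite !big_ord_recl big_ord0 addr0 !addrA. Qed.


Section Rep.
Context (g1 g2 g3 g4 : 'M[F]_4).
Hypotheses (g11 : g1 *m g1 = - 1%:M) (g22 : g2 *m g2 = - 1%:M)
  (g33 : g3 *m g3 = - 1%:M) (g44 : g4 *m g4 = - 1%:M)
  (g12 : g1 *m g2 = - (g2 *m g1)) (g13 : g1 *m g3 = - (g3 *m g1))
  (g14 : g1 *m g4 = - (g4 *m g1)) (g23 : g2 *m g3 = - (g3 *m g2))
  (g24 : g2 *m g4 = - (g4 *m g2)) (g34 : g3 *m g4 = - (g4 *m g3)).

Let I1 := g1 *m g2.
Let I2 := g3 *m g4.

Lemma I1I1 : I1 *m I1 = - 1%:M.
Proof.
by rewrite /I1 {1}g12 mulNmx mulmxA -(mulmxA g2) g11 mulmxN mulmx1 mulNmx g22 !opprK.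
Qed.

Lemma I2I2 : I2 *m I2 = - 1%:M.
Proof.
by rewrite /I2 {1}g34 mulNmx mulmxA -(mulmxA g4) g33 mulmxN mulmx1 mulNmx g44 !opprK.
Qed.

Lemma anti_commM (A B C : 'M[F]_4) : A *m B = - (B *m A) -> A *m C = - (C *m A) ->
  A *m (B *m C) = B *m C *m A.
Proof. by move=> e f; by rewrite mulmxA e mulNmx -(mulmxA B A) f mulmxN opprK mulmxA. Qed.

Lemma I1I2 : I1 *m I2 = I2 *m I1.
Proof.
by rewrite /I1 /I2 -mulmxA (anti_commM g23 g24) mulmxA (anti_commM g13 g14) !mulmxA.
Qed.

Lemma eigenprojection (J : 'M[F]_4) : J *m J = - 1%:M ->
  J *m (1%:M - i *: J) = i *: (1%:M - i *: J).
Proof.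
move=> JJ; rewrite mulmxBr mulmx1 -scalemxAr JJ scalerN opprK.
by rewrite scalerBr scalerA ii scaleN1r opprK addrC.
Qed.

Lemma eigenprojection_pos (J : 'M[F]_4) (w : 'cV_4) : J *m w = i *: w ->
  (1%:M - i *: J) *m w = 2 *: w.
Proof.
by move=> e; rewrite mulmxBl mul1mx -scalemxAl e scalerA ii scaleN1r opprK -mulr2n scaler_nat.
Qed.

Lemma eigenprojection_neg (J : 'M[F]_4) (w : 'cV_4) : J *m w = - i *: w ->
  (1%:M - i *: J) *m w = 0.
Proof.
by move=> e; rewrite mulmxBl mul1mx -scalemxAl e scalerA mulrN ii opprK scale1r subrr.
Qed.

Lemma comm_eigenprojection : (1%:M - i *: I1) *m (1%:M - i *: I2) =
  (1%:M - i *: I2) *m (1%:M - i *: I1).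
Proof.
rewrite !mulmxBl !mulmxBr !mulmx1 !mul1mx -!scalemxAl -!scalemxAr I1I2.
by rewrite !opprB addrACA [RHS]addrACA; congr (_ + _); rewrite addrC.
Qed.

Lemma tr_anti (A B : 'M[F]_4) : A *m B = - (B *m A) -> \tr (A *m B) = 0.
Proof.
move=> e; have : \tr (A *m B) + \tr (A *m B) = 0.
  by rewrite {1}e raddfN /= mxtrace_mulC addNr.
by rewrite -mulr2n -mulr_natl => /eqP; rewrite mulf_eq0 (negbTE two) => /eqP.
Qed.

(** The traces of I1, I2 and I1 I2 vanish because each is a product of two
    anticommuting matrices; so the product P of the two eigenprojections (up to
    the factor 4) has trace 4, and any nonzero column of P will do. *)
Lemma joint_eigenvector :
  exists2 v : 'cV[F]_4, v != 0 & I1 *m v = i *: v /\ I2 *m v = i *: v.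
Proof.
pose P := (1%:M - i *: I1) *m (1%:M - i *: I2).
have I1P : I1 *m P = i *: P by rewrite /P mulmxA eigenprojection ?I1I1 -?scalemxAl.
have I2P : I2 *m P = i *: P.
  by rewrite /P comm_eigenprojection mulmxA eigenprojection ?I2I2 -?scalemxAl.
have trI12 : \tr (I1 *m I2) = 0.
  rewrite /I1 /I2 -mulmxA; apply: tr_anti.
  rewrite (mulmxA g2 g3) mulmxA (anti_commM g12 g13) -(mulmxA (g2 *m g3)) g14.
  by rewrite mulmxN mulmxA.
have trP : \tr P = 4%:R.
  rewrite /P mulmxBl !mulmxBr !mul1mx !mulmx1 -!scalemxAl -!scalemxAr !raddfB /= !linearZ /=.
  have [-> ->] : \tr I1 = 0 /\ \tr I2 = 0 by split; exact: tr_anti.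
  by rewrite trI12 !mulr0 !subr0 mxtrace1 subrr addr0.
have /matrix0Pn [a [b Pab]] : P != 0.
  apply/eqP => P0; move: trP; rewrite P0 raddf0 => /esym/eqP.
  by rewrite (_ : 4%:R = 2 * 2 :> F) ?mulf_eq0 ?orbb ?(negbTE two) //; ring.
exists (col b P); first by apply/matrix0Pn; exists a, ord0; rewrite mxE.
by rewrite colE (mulmxA I1 P) (mulmxA I2 P) I1P I2P -!scalemxAl.
Qed.

(** Four Clifford generators have a unique representation on a space of
    dimension 4. The vectors v, g1 v, g3 v, g1 g3 v lie in the four joint
    eigenspaces of I1 and I2, so they form a basis, and the relations determine
    how each generator permutes them. *)
Lemma clifford4_rep : exists2 G : 'M[F]_4, G \in unitmx &
  [/\ g1 *m G = G *m std1, g2 *m G = G *m std2, g3 *m G = G *m std3 & g4 *m G = G *m std4].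
Proof.
have [v v0 [v12 v34]] := joint_eigenvector.
pose c1 := g1 *m v; pose c2 := g3 *m v; pose c3 := g1 *m c2.
pose G : 'M[F]_4 := \matrix_(j, k) nth v [:: v; c1; c2; c3] k j 0.
have g2v : g2 *m v = - i *: c1.
  rewrite /c1 scaleNr scalemxAr -v12 /I1 !mulmxA g11 !mulNmx mul1mx opprK //.
have g4v : g4 *m v = - i *: c2.
  rewrite /c2 scaleNr scalemxAr -v34 /I2 !mulmxA g33 !mulNmx mul1mx opprK //.
have t1 : [/\ g1 *m c1 = - v, g1 *m c2 = c3 & g1 *m c3 = - c2].
  by split=> //; rewrite /c3 /c1 mulmxA g11 mulNmx mul1mx.
have t3 : [/\ g3 *m c1 = - c3, g3 *m c2 = - v & g3 *m c3 = c1].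
  split; rewrite /c3 /c1 /c2 !mulmxA.
  - by rewrite g13 mulNmx opprK.
  - by rewrite g33 mulNmx mul1mx.
  - by rewrite -[g3 *m g1]opprK -g13 mulNmx -(mulmxA g1) g33 mulmxN mulmx1 opprK.
have t2 : [/\ g2 *m c1 = - i *: v, g2 *m c2 = - i *: c3 & g2 *m c3 = - i *: c2].
  have e2 : g2 *m c2 = - i *: c3.
    rewrite /c2 mulmxA g23 mulNmx -mulmxA g2v -scalemxAr /c1 mulmxA.
    by rewrite /c3 /c2 mulmxA g13 mulNmx scalerN.
  split => //.
    by rewrite /c1 mulmxA -[g2 *m g1]opprK -g12 mulNmx v12 scaleNr.
  rewrite /c3 mulmxA -[g2 *m g1]opprK -g12 mulNmx -mulmxA e2 -scalemxAr.
  by case: t1 => _ _ ->; rewrite scalerN opprK.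
have t4 : [/\ g4 *m c1 = i *: c3, g4 *m c2 = - i *: v & g4 *m c3 = i *: c1].
  have e2 : g4 *m c2 = - i *: v.
    by rewrite /c2 mulmxA -[g4 *m g3]opprK -g34 mulNmx v34 scaleNr.
  split => //.
    by rewrite /c1 mulmxA -[g4 *m g1]opprK -g14 mulNmx -mulmxA g4v -scalemxAr scaleNr opprK.
  by rewrite /c3 mulmxA -[g4 *m g1]opprK -g14 mulNmx -mulmxA e2 -scalemxAr scaleNr opprK.
have GE (A : 'M[F]_4) j k : (A *m G) j k = (A *m nth v [:: v; c1; c2; c3] k) j 0.
  by rewrite !mxE; apply: eq_bigr => l _; rewrite mxE.
have actG (A S : 'M[F]_4) :
    (forall k : 'I_4, A *m nth v [:: v; c1; c2; c3] k =
      S ord0 k *: v + S (lift ord0 ord0) k *: c1 + S (lift ord0 (lift ord0 ord0)) k *: c2 +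
      S (lift ord0 (lift ord0 (lift ord0 ord0))) k *: c3) -> A *m G = G *m S.
  move=> e; apply: eq_mx4 => j k; rewrite GE e [RHS]mxE sum4 !mxE /=.
  by rewrite !(mulrC (S _ _)).
have v1 : g1 *m v = c1 by []. have v3 : g3 *m v = c2 by [].
case: t1 t2 t3 t4 => a1 a2 a3 [b1 b2 b3] [d1 d2 d3] [e1 e2 e3].
exists G; last first.
  split; apply: actG; apply: forall4; rewrite !mxE /= ?(v1, v3, g2v, g4v, a1, a2, a3, b1, b2, b3, d1, d2, d3, e1, e2, e3);
    by rewrite ?(scale0r, add0r, addr0, scale1r, scaleN1r).
have /matrix0Pn [k0 [l0]] := v0; rewrite (ord1 l0) => vk.
(* The linear form l is 1 on v and vanishes on the other three vectors, since
   Q annihilates them; composing l with products of generators gives the dual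
   basis, that is, the rows of the inverse of G. *)
pose Q := (1%:M - i *: I1) *m (1%:M - i *: I2).
pose l : 'rV[F]_4 := (4 * v k0 0)^-1 *: (delta_mx 0 k0 *m Q).
have Qv : Q *m v = 4 *: v.
  rewrite /Q -mulmxA (eigenprojection_pos v34) -scalemxAr (eigenprojection_pos v12).
  by rewrite scalerA; congr (_ *: _); ring.
have I1c1 : I1 *m c1 = - i *: c1 by rewrite /I1 -mulmxA b1 -scalemxAr.
have I1c3 : I1 *m c3 = - i *: c3 by rewrite /I1 -mulmxA b3 -scalemxAr a2.
have I2c2 : I2 *m c2 = - i *: c2 by rewrite /I2 -mulmxA e2 -scalemxAr.
have QE (w : 'cV[F]_4) : I1 *m w = - i *: w \/ I2 *m w = - i *: w -> Q *m w = 0.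
  case=> /eigenprojection_neg e.
    by rewrite /Q comm_eigenprojection -mulmxA e mulmx0.
  by rewrite /Q -mulmxA e mulmx0.
have lE (w : 'cV[F]_4) : l *m w = (4 * v k0 0)^-1 *: (delta_mx 0 k0 *m (Q *m w)).
  by rewrite /l -scalemxAl mulmxA.
have four : (4 : F) != 0 by rewrite (_ : 4 = 2 * 2) ?mulf_neq0 //; ring.
have lv : l *m v = 1%:M.
  rewrite lE Qv -scalemxAr -rowE scalerA invfM mulrC mulrA mulfV // mul1r.
  apply/matrixP => r s; rewrite !ord1 !mxE /=.
  by rewrite mulVf.
have lc1 : l *m c1 = 0 by rewrite lE QE ?mulmx0 ?scaler0 //; left.
have lc3 : l *m c3 = 0 by rewrite lE QE ?mulmx0 ?scaler0 //; left.
have lc2 : l *m c2 = 0 by rewrite lE QE ?mulmx0 ?scaler0 //; right.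
pose H : 'M[F]_4 := \matrix_(j, k) nth l [:: l; - (l *m g1); - (l *m g3); l *m g3 *m g1] j 0 k.
have HG : H *m G = 1%:M.
  have HE j k : (H *m G) j k = (nth l [:: l; - (l *m g1); - (l *m g3); l *m g3 *m g1] j
       *m nth v [:: v; c1; c2; c3] k) 0 0.
    by rewrite !mxE; apply: eq_bigr => r _; rewrite !mxE.
  apply: eq_mx4; apply: forall4; apply: forall4; rewrite HE /= ?mulNmx -?mulmxA;
    do ?rewrite ?(v1, v3, a1, a2, a3, d1, d2, d3, lv, lc1, lc2, lc3, mulmxN) /=;
    by rewrite ?(oppr0, opprK) !mxE.
by case: (mulmx1_unit HG).
Qed.

End Rep.
End CliffordRep.

(** * The invariant symplectic form and its quadratic covariants *)

Section ChargeConjugation.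
Context (F : fieldType) (i : F).
Hypotheses (ii : i * i = -1) (two : (2 : F) != 0).

Lemma i_neq0 : i != 0.
Proof. by apply/eqP => i0; move/eqP: ii; rewrite i0 mul0r eq_sym oppr_eq0 oner_eq0. Qed.

Definition clifford_rel n (g : 'I_n -> 'M[F]_4) :=
  forall j k, g j *m g k + g k *m g j = (- (2 * (j == k)%:R))%:M.

Lemma clifford_sq n (g : 'I_n -> 'M[F]_4) j : clifford_rel g -> g j *m g j = - 1%:M.
Proof.
move=> /(_ j j); rewrite eqxx mulr1 -mulr2n -scaler_nat raddfN /= => e.
by apply: (scalerI two); rewrite e scalerN scalemx1.
Qed.

Lemma clifford_anti n (g : 'I_n -> 'M[F]_4) j k : clifford_rel g -> j != k ->
  g j *m g k = - (g k *m g j).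
Proof.
move=> /(_ j k) + /negbTE jk; rewrite jk mulr0 oppr0 raddf0 => e.
by apply: (addIr (g k *m g j)); rewrite e addNr.
Qed.

Definition diag4 (s : seq F) : 'M[F]_4 := \matrix_(j, k) (nth 0 s j *+ (j == k)).

Lemma std12 : std1 F *m std2 i = diag4 [:: i; -i; i; -i].
Proof. by apply: eq_mx4; apply: forall4; apply: forall4; rewrite !mxE sum4 !mxE /=; ring. Qed.

Lemma std34 : std3 F *m std4 i = diag4 [:: i; i; -i; -i].
Proof. by apply: eq_mx4; apply: forall4; apply: forall4; rewrite !mxE sum4 !mxE /=; ring. Qed.

Lemma stdB_std : [/\ stdB F *m std1 F = (std1 F)^T *m stdB F,
  stdB F *m std2 i = (std2 i)^T *m stdB F,
  stdB F *m std3 F = (std3 F)^T *m stdB F &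
  stdB F *m std4 i = (std4 i)^T *m stdB F].
Proof.
by split; apply: eq_mx4; apply: forall4; apply: forall4; rewrite !mxE !sum4 !mxE /=; ring.
Qed.

Lemma stdB_anti : (stdB F)^T = - stdB F.
Proof. by apply: eq_mx4; apply: forall4; apply: forall4; rewrite !mxE /= ?oppr0 ?opprK. Qed.

Lemma stdB_unit : stdB F \in unitmx.
Proof.
have : stdB F *m - stdB F = 1%:M.
  by apply: eq_mx4; apply: forall4; apply: forall4; rewrite !mxE sum4 !mxE /=; ring.
by case/mulmx1_unit.
Qed.

Lemma eq_opp0 (x : F) : x = - x -> x = 0.
Proof. by move=> e; apply/eqP; rewrite -(mulrI_eq0 _ (mulfI two)) mulr_natl mulr2n {1}e addNr. Qed.

Lemma ieq0 (x y : F) : i * x = i * y -> x = y.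
Proof. exact: (mulfI i_neq0). Qed.

Lemma i_neqN : i != - i.
Proof. by apply/eqP => /eq_opp0/eqP; rewrite (negbTE i_neq0). Qed.

Lemma mul_diag4 (A : 'M[F]_4) s j k : (A *m diag4 s) j k = A j k * nth 0 s k.
Proof.
rewrite mxE (bigD1 k) //= big1 ?addr0; first by rewrite mxE eqxx mulr1n.
by move=> l lk; rewrite mxE (negbTE lk) mulr0.
Qed.

Lemma diag4_mul (A : 'M[F]_4) s j k : (diag4 s *m A) j k = nth 0 s j * A j k.
Proof.
rewrite mxE (bigD1 j) //= big1 ?addr0; first by rewrite mxE eqxx mulr1n.
by move=> l lk; rewrite mxE eq_sym (negbTE lk) mul0r.
Qed.

Lemma diag4_comm (A : 'M[F]_4) s (j k : 'I_4) : A *m diag4 s = diag4 s *m A ->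
  nth 0 s j != nth 0 s k -> A j k = 0.
Proof.
move=> /matrixP/(_ j k); rewrite mul_diag4 diag4_mul mulrC => /eqP.
by rewrite -subr_eq0 -mulrBl mulf_eq0 subr_eq0 eq_sym => /orP[->|/eqP].
Qed.

(** A fifth generator commutes with g1 g2 and g3 g4, which separate the basis, and
    changes sign under g1 and g3. *)
Lemma std5_diag (S : 'M[F]_4) :
  S *m std1 F = - (std1 F *m S) -> S *m std2 i = - (std2 i *m S) ->
  S *m std3 F = - (std3 F *m S) -> S *m std4 i = - (std4 i *m S) ->
  exists c, S = diag4 [:: c; -c; -c; c].
Proof.
move=> e1 e2 e3 e4.
have d12 : S *m diag4 [:: i; -i; i; -i] = diag4 [:: i; -i; i; -i] *m S.
  by rewrite -std12 (anti_commM e1 e2).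
have d34 : S *m diag4 [:: i; i; -i; -i] = diag4 [:: i; i; -i; -i] *m S.
  by rewrite -std34 (anti_commM e3 e4).
exists (S ord0 ord0); apply: eq_mx4 => j k.
move: j k; apply: forall4; apply: forall4; rewrite [RHS]mxE /=;
  (try by apply: (diag4_comm d12); exact: i_neqN);
  (try by apply: (diag4_comm d34); exact: i_neqN);
  (try by apply: (diag4_comm d12); rewrite eq_sym; exact: i_neqN);
  (try by apply: (diag4_comm d34); rewrite eq_sym; exact: i_neqN) => //.
- have /matrixP/(_ (lift ord0 ord0) ord0) := e1.
  by rewrite !mxE !sum4 !mxE /= !(mulr0, mul0r, mulr1, mul1r, addr0, add0r).
- have /matrixP/(_ (lift ord0 (lift ord0 ord0)) ord0) := e3.
  by rewrite !mxE !sum4 !mxE /= !(mulr0, mul0r, mulr1, mul1r, addr0, add0r).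
- have /matrixP/(_ (lift ord0 (lift ord0 (lift ord0 ord0))) (lift ord0 (lift ord0 ord0))) := e1.
  have /matrixP/(_ (lift ord0 (lift ord0 ord0)) ord0) := e3.
  by rewrite !mxE !sum4 !mxE /= !(mulr0, mul0r, mulr1, mul1r, addr0, add0r) => -> ->; rewrite opprK.
Qed.

(** The charge conjugation form, for which all vectors are self-adjoint. In the
    standard basis of the first four generators it is stdB, and the shape of the
    fifth generator is compatible with it. *)
Lemma charge_conjugation (g : 'I_5 -> 'M[F]_4) : clifford_rel g ->
  exists2 B, B \in unitmx & B^T = - B /\ forall j, B *m g j = (g j)^T *m B.
Proof.
move=> hg.
pose k0 : 'I_5 := ord0. pose k1 : 'I_5 := lift ord0 ord0.
pose k2 : 'I_5 := lift ord0 (lift ord0 ord0).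
pose k3 : 'I_5 := lift ord0 (lift ord0 (lift ord0 ord0)).
pose k4 : 'I_5 := lift ord0 (lift ord0 (lift ord0 (lift ord0 ord0))).
have sq j := clifford_sq j hg. have an j k := @clifford_anti _ g j k hg.
have [G uG [G1 G2 G3 G4]] := clifford4_rep ii two (sq k0) (sq k1) (sq k2) (sq k3)
  (an k0 k1 isT) (an k0 k2 isT) (an k0 k3 isT) (an k1 k2 isT) (an k1 k3 isT) (an k2 k3 isT).
pose H := invmx G.
have GH : G *m H = 1%:M by exact: mulmxV.
have HG : H *m G = 1%:M by exact: mulVmx.
pose S := H *m g k4 *m G.
have G5 : g k4 *m G = G *m S by rewrite /S !mulmxA GH mul1mx.
have Hg k s : g k *m G = G *m s -> H *m g k = s *m H.
  by move=> e; rewrite -[s]mul1mx -HG -(mulmxA H) -e -!mulmxA GH mulmx1.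
have antiS k s : g k *m G = G *m s -> k4 != k -> S *m s = - (s *m S).
  move=> e /an e2; rewrite /S -!mulmxA -e (mulmxA (g k4)) e2 mulNmx mulmxN !mulmxA.
  by rewrite (Hg _ _ e).
have [c Sc] := std5_diag (antiS _ _ G1 isT) (antiS _ _ G2 isT) (antiS _ _ G3 isT) (antiS _ _ G4 isT).
exists (H^T *m stdB F *m H); first by rewrite !unitmx_mul unitmx_tr unitmx_inv uG stdB_unit.
split; first by rewrite !trmx_mul trmxK stdB_anti mulNmx mulmxN mulmxA.
have inv k s : g k *m G = G *m s -> stdB F *m s = s^T *m stdB F ->
    H^T *m stdB F *m H *m g k = (g k)^T *m (H^T *m stdB F *m H).
  move=> e es.
  by rewrite -!mulmxA (Hg _ _ e) !mulmxA -trmx_mul (Hg _ _ e) trmx_mul -(mulmxA H^T _ s) es !mulmxA.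
have [B1 B2 B3 B4] := stdB_std.
have B5 : stdB F *m S = S^T *m stdB F.
  by rewrite Sc; apply: eq_mx4; apply: forall4; apply: forall4; rewrite !mxE !sum4 !mxE /=; ring.
move=> j.
case: (unliftP ord0 j) => [j1 ->|->]; last exact: inv G1 B1.
case: (unliftP ord0 j1) => [j2 ->|->]; last exact: inv G2 B2.
case: (unliftP ord0 j2) => [j3 ->|->]; last exact: inv G3 B3.
case: (unliftP ord0 j3) => [j4 ->|->]; last exact: inv G4 B4.
by rewrite (ord1 j4); exact: inv G5 B5.
Qed.

Lemma std21 : std2 i *m std1 F = - diag4 [:: i; -i; i; -i].
Proof. by apply: eq_mx4; apply: forall4; apply: forall4; rewrite !mxE sum4 !mxE /=; ring. Qed.

Lemma std43 : std4 i *m std3 F = - diag4 [:: i; i; -i; -i].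
Proof. by apply: eq_mx4; apply: forall4; apply: forall4; rewrite !mxE sum4 !mxE /=; ring. Qed.

Lemma diag4_tr s : (diag4 s)^T = diag4 s.
Proof. by apply/matrixP => j k; rewrite !mxE eq_sym; case: eqP => // ->. Qed.

Lemma diag4_skew (A : 'M[F]_4) s (j k : 'I_4) : A *m diag4 s = - (diag4 s *m A) ->
  nth 0 s j != - nth 0 s k -> A j k = 0.
Proof.
move=> /matrixP/(_ j k); rewrite mul_diag4 mxE diag4_mul mulrC => /eqP.
by rewrite -subr_eq0 opprK -mulrDl mulf_eq0 addrC addr_eq0 => /orP[->|/eqP].
Qed.

(** The products g1 g2 and g3 g4 are skew for an invariant form, so that only
    basis vectors with opposite eigenvalues are paired; g1 and g3 relate the
    four remaining entries. *)
Lemma invariant_form_unique (A : 'M[F]_4) :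
  A *m std1 F = (std1 F)^T *m A -> A *m std2 i = (std2 i)^T *m A ->
  A *m std3 F = (std3 F)^T *m A -> A *m std4 i = (std4 i)^T *m A ->
  A = A ord0 (lift ord0 (lift ord0 (lift ord0 ord0))) *: stdB F.
Proof.
move=> e1 e2 e3 e4.
have d12 : A *m diag4 [:: i; -i; i; -i] = - (diag4 [:: i; -i; i; -i] *m A).
  by rewrite -std12 mulmxA e1 -mulmxA e2 mulmxA -trmx_mul std21 raddfN /= diag4_tr mulNmx std12.
have d34 : A *m diag4 [:: i; i; -i; -i] = - (diag4 [:: i; i; -i; -i] *m A).
  by rewrite -std34 mulmxA e3 -mulmxA e4 mulmxA -trmx_mul std43 raddfN /= diag4_tr mulNmx std34.
have ni : - - i != - i by rewrite opprK; exact: i_neqN.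
have iN := i_neqN.
apply: eq_mx4; apply: forall4; apply: forall4; rewrite [RHS]mxE [stdB F _ _]mxE /= ?mulr0 ?mulr1 //;
  (try by apply: (diag4_skew d12); rewrite /= ?opprK // eq_sym);
  (try by apply: (diag4_skew d34); rewrite /= ?opprK // eq_sym).
- have /matrixP/(_ ord0 (lift ord0 (lift ord0 ord0))) := e1.
  by rewrite !mxE !sum4 !mxE /= !(mulr0, mul0r, mulr1, mul1r, addr0, add0r) => ->.
- have /matrixP/(_ ord0 (lift ord0 ord0)) := e3.
  by rewrite !mxE !sum4 !mxE /= !(mulr0, mul0r, mulr1, mul1r, addr0, add0r) => ->.
- have /matrixP/(_ ord0 (lift ord0 ord0)) := e3.
  have /matrixP/(_ (lift ord0 (lift ord0 ord0)) ord0) := e1.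
  by rewrite !mxE !sum4 !mxE /= !(mulr0, mul0r, mulr1, mul1r, addr0, add0r) => -> ->.
Qed.

Section Quadratic.
Context (g1 g2 g3 g4 B : 'M[F]_4) (psi : 'cV[F]_4).
Hypotheses (g11 : g1 *m g1 = - 1%:M) (g22 : g2 *m g2 = - 1%:M)
  (g33 : g3 *m g3 = - 1%:M) (g44 : g4 *m g4 = - 1%:M)
  (g12 : g1 *m g2 = - (g2 *m g1)) (g13 : g1 *m g3 = - (g3 *m g1))
  (g14 : g1 *m g4 = - (g4 *m g1)) (g23 : g2 *m g3 = - (g3 *m g2))
  (g24 : g2 *m g4 = - (g4 *m g2)) (g34 : g3 *m g4 = - (g4 *m g3)).
Hypotheses (uB : B \in unitmx) (B1 : B *m g1 = g1^T *m B) (B2 : B *m g2 = g2^T *m B)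
  (B3 : B *m g3 = g3^T *m B) (B4 : B *m g4 = g4^T *m B).

Definition quad (A : 'M[F]_4) : F := (psi^T *m B *m A *m psi) 0 0.

(** Here x0, ..., x3 are the coordinates of psi in the standard basis of g1, ..., g4,
    in which B is a multiple b of stdB by uniqueness. *)
Lemma quad_coord : exists b x0 x1 x2 x3 : F,
  [/\ b != 0, (x0 = 0 -> x1 = 0 -> x2 = 0 -> x3 = 0 -> psi = 0) &
   [/\ quad (g1 *m g3) = b * (x0 * x0 + x1 * x1 + x2 * x2 + x3 * x3),
       quad (g2 *m g4) = b * (- (x0 * x0) + x1 * x1 + x2 * x2 - x3 * x3),
       quad (g1 *m g4) = b * (- i * (x0 * x0 + x1 * x1 - x2 * x2 - x3 * x3)),
       quad (g2 *m g3) = b * (- i * (x0 * x0 - x1 * x1 + x2 * x2 - x3 * x3)) &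
       quad (g1 *m g2 + g3 *m g4) = b * (- 4 * i * (x0 * x3))]].
Proof.
have [G uG [G1 G2 G3 G4]] := clifford4_rep ii two g11 g22 g33 g44 g12 g13 g14 g23 g24 g34.
pose A := G^T *m B *m G.
have As g s : g *m G = G *m s -> B *m g = g^T *m B -> A *m s = s^T *m A.
  by move=> e eb; rewrite /A -!mulmxA -e (mulmxA B) eb !mulmxA -trmx_mul e trmx_mul.
have A1 := As _ _ G1 B1. have A2 := As _ _ G2 B2.
have A3 := As _ _ G3 B3. have A4 := As _ _ G4 B4.
have Ab := invariant_form_unique A1 A2 A3 A4.
pose b := A ord0 (lift ord0 (lift ord0 (lift ord0 ord0))).
pose x := invmx G *m psi.
have px : psi = G *m x by rewrite /x mulmxA mulmxV // mul1mx.
clearbody x.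
have b0 : b != 0.
  apply/eqP => bz; have : A \in unitmx by rewrite !unitmx_mul unitmx_tr uG uB.
  by rewrite Ab -/b bz scale0r unitmxE det0 unitr0.
have qE g s : g *m G = G *m s -> quad g = b * (x^T *m stdB F *m s *m x) 0 0.
  move=> e; have -> : b * (x^T *m stdB F *m s *m x) 0 0 = (x^T *m A *m s *m x) 0 0.
    by rewrite Ab -/b -scalemxAr -!scalemxAl [RHS]mxE.
  by rewrite /quad px trmx_mul /A -!mulmxA (mulmxA G s) -e -!mulmxA.
have mul2 g s g' s' : g *m G = G *m s -> g' *m G = G *m s' -> g *m g' *m G = G *m (s *m s').
  by move=> e e'; rewrite -mulmxA e' mulmxA e -mulmxA.
exists b, (x ord0 0), (x (lift ord0 ord0) 0), (x (lift ord0 (lift ord0 ord0)) 0),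
  (x (lift ord0 (lift ord0 (lift ord0 ord0))) 0).
split => //.
  move=> x0 x1 x2 x3; rewrite px (_ : x = 0) ?mulmx0 //.
  by apply/colP; apply: forall4; rewrite mxE.
split.
- rewrite (qE _ _ (mul2 _ _ _ _ G1 G3)); congr (_ * _).
  by rewrite !mxE !sum4 !mxE !sum4 !mxE !sum4 !mxE /=; ring.
- rewrite (qE _ _ (mul2 _ _ _ _ G2 G4)); congr (_ * _).
  rewrite -[RHS]opprK -mulN1r -ii.
  by rewrite !mxE !sum4 !mxE !sum4 !mxE !sum4 !mxE /=; ring.
- rewrite (qE _ _ (mul2 _ _ _ _ G1 G4)); congr (_ * _).
  by rewrite !mxE !sum4 !mxE !sum4 !mxE !sum4 !mxE /=; ring.
- rewrite (qE _ _ (mul2 _ _ _ _ G2 G3)); congr (_ * _).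
  by rewrite !mxE !sum4 !mxE !sum4 !mxE !sum4 !mxE /=; ring.
rewrite (qE _ (std1 F *m std2 i + std3 F *m std4 i)); last first.
  by rewrite mulmxDl mulmxDr (mul2 _ _ _ _ G1 G2) (mul2 _ _ _ _ G3 G4).
congr (_ * _); rewrite std12 std34.
by rewrite !mxE !sum4 !mxE !sum4 !mxE !sum4 !mxE /=; ring.
Qed.

Lemma sqr0 (x : F) : x * x = 0 -> x = 0.
Proof. by move=> /eqP; rewrite mulf_eq0 orbb => /eqP. Qed.

Lemma double0 (x : F) : x + x = 0 -> x = 0.
Proof. by move=> /eqP; rewrite addr_eq0 => /eqP/eq_opp0. Qed.

(** With respect to the complex structure that maps e1 to e2 and e3 to e4, the
    two-forms e13 - e24 and e14 + e23 span the type (2,0) + (0,2), and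
    e12 + e34 is the Kaehler form. The first two give the quadratic forms
    x0^2 + x3^2 and x0^2 - x3^2, the last one x0 x3. *)
Lemma quad_skew_types : quad (g1 *m g3) = quad (g2 *m g4) ->
  quad (g1 *m g4) = - quad (g2 *m g3) -> quad (g1 *m g2 + g3 *m g4) = 0.
Proof.
have [b [x0 [x1 [x2 [x3 [b0 _ [-> -> -> -> ->]]]]]]] := quad_coord.
have inj (t t' : F) : b * t = b * t' -> t = t' by exact: mulfI.
move=> /inj e1 e2; have {}e2 := inj _ _ (etrans e2 (esym (mulrN _ _))).
have e3 : x0 * x0 + x3 * x3 = 0.
  apply: double0; move/eqP: e1; rewrite -subr_eq0 => /eqP <-; ring.
have e4 : x0 * x0 - x3 * x3 = 0.
  apply: double0; apply: ieq0; rewrite mulr0; move/eqP: e2; rewrite -subr_eq0 => /eqP.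
  by move=> /(congr1 -%R); rewrite oppr0 => <-; ring.
have -> : x0 = 0 by apply: sqr0; apply: double0; rewrite -[RHS]addr0 -{1}e3 -e4; ring.
by rewrite mul0r !mulr0.
Qed.

(** The four values are, up to factors, the squares x0^2, ..., x3^2 transformed by
    a Hadamard matrix. *)
Lemma quad_horizontal0 : quad (g1 *m g3) = 0 -> quad (g2 *m g4) = 0 ->
  quad (g1 *m g4) = 0 -> quad (g2 *m g3) = 0 -> psi = 0.
Proof.
have [b [x0 [x1 [x2 [x3 [b0 px [-> -> -> -> _]]]]]]] := quad_coord.
have bz (t : F) : b * t = 0 -> t = 0 by move=> /eqP; rewrite mulf_eq0 (negbTE b0) => /eqP.
have iz (t : F) : - i * t = 0 -> t = 0.
  by move=> /eqP; rewrite mulf_eq0 oppr_eq0 (negbTE i_neq0) => /eqP.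
move=> /bz e1 /bz e2 /bz/iz e3 /bz/iz e4.
have z (t : F) : t * t + t * t + (t * t + t * t) = 0 -> t = 0.
  by move=> /double0/double0/sqr0.
move: e1 e2 e3 e4.
set s1 := (X in X = 0); set s2 := (X in _ -> X = 0 -> _); set s3 := (X in _ -> _ -> X = 0 -> _).
set s4 := (X in _ -> _ -> _ -> X = 0 -> _) => e1 e2 e3 e4.
apply: px; apply: z.
- by transitivity (s1 - s2 + s3 + s4); [rewrite /s1 /s2 /s3 /s4|rewrite e1 e2 e3 e4]; ring.
- by transitivity (s1 + s2 + s3 - s4); [rewrite /s1 /s2 /s3 /s4|rewrite e1 e2 e3 e4]; ring.
- by transitivity (s1 + s2 - s3 + s4); [rewrite /s1 /s2 /s3 /s4|rewrite e1 e2 e3 e4]; ring.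
- by transitivity (s1 - s2 - s3 - s4); [rewrite /s1 /s2 /s3 /s4|rewrite e1 e2 e3 e4]; ring.
Qed.
End Quadratic.

End ChargeConjugation.

(** * Contact linear algebra in one tangent space *)

(** The tangent space at a point, its metric and the value of a local frame there.
    Working in an abstract V keeps the derivations of functions out of sight. *)
Record orthonormal_frame (R : realType) (V : lmodType R) (g : V -> V -> R)
    (e : 'I_5 -> V) : Prop := OrthonormalFrame {
  frame_form_sym : forall u v, g u v = g v u;
  frame_form_lin : forall a u u' v, g (a *: u + u') v = a * g u v + g u' v;
  frame_delta : forall a b, g (e a) (e b) = (a == b)%:R;
  frame_span : forall v, exists c : 'I_5 -> R, v = \sum_a c a *: e a
}.

(** The values at a point of the tensors of a Sasakian structure; eta is
    represented as the pairing with xi. *)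
Record contact_tensors (R : realType) (V : lmodType R) (g : V -> V -> R)
    (phi : V -> V) (xi : V) : Prop := ContactTensors {
  contact_phi_lin : forall a u v, phi (a *: u + v) = a *: phi u + phi v;
  contact_phi_phi : forall u, phi (phi u) = - u + g u xi *: xi;
  contact_phi_skew : forall u v, g (phi u) v = - g u (phi v);
  contact_xi_unit : g xi xi = 1;
  contact_phi_xi : phi xi = 0
}.

Section ContactAlgebra.
Context (R : realType) (V : lmodType R) (g : V -> V -> R) (e : 'I_5 -> V)
  (phi : V -> V) (xi : V).
Local Notation C := R[i].
Hypothesis E : orthonormal_frame g e.
Local Notation g_sym := (frame_form_sym E).
Local Notation g_lin := (frame_form_lin E).
Local Notation e_orth := (frame_delta E).
Local Notation e_basis := (frame_span E).

Lemma gDl u u' v : g (u + u') v = g u v + g u' v.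
Proof. by rewrite -[u]scale1r g_lin mul1r scale1r. Qed.

Lemma g0l v : g 0 v = 0.
Proof. by apply: (addrI (g 0 v)); rewrite -gDl !addr0. Qed.

Lemma gZl a u v : g (a *: u) v = a * g u v.
Proof. by rewrite -[a *: u]addr0 g_lin g0l addr0. Qed.

Lemma gNl u v : g (- u) v = - g u v.
Proof. by rewrite -scaleN1r gZl mulN1r. Qed.

Lemma gDr u v v' : g u (v + v') = g u v + g u v'.
Proof. by rewrite !(g_sym u) gDl. Qed.

Lemma gZr a u v : g u (a *: v) = a * g u v.
Proof. by rewrite !(g_sym u) gZl. Qed.

Lemma gNr u v : g u (- v) = - g u v.
Proof. by rewrite !(g_sym u) gNl. Qed.

Lemma g0r v : g v 0 = 0.
Proof. by rewrite g_sym g0l. Qed.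

Lemma g_suml (I : finType) (F : I -> V) v : g (\sum_a F a) v = \sum_a g (F a) v.
Proof. by elim/big_rec2: _ => [|a x y _ <-]; rewrite ?g0l ?gDl. Qed.

Lemma g_sumr (I : finType) (F : I -> V) v : g v (\sum_a F a) = \sum_a g v (F a).
Proof. by rewrite g_sym g_suml; apply: eq_bigr => a _; rewrite g_sym. Qed.

Lemma frame_coord (c : 'I_5 -> R) a : g (\sum_b c b *: e b) (e a) = c a.
Proof.
rewrite g_suml (bigD1 a) //= gZl e_orth eqxx mulr1 big1 ?addr0 // => b ba.
by rewrite gZl e_orth (negbTE ba) mulr0.
Qed.

Lemma frame_expand v : v = \sum_a g v (e a) *: e a.
Proof. by have [c ->] := e_basis v; apply: eq_bigr => a _; rewrite frame_coord. Qed.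

Lemma parseval u v : g u v = \sum_a g u (e a) * g v (e a).
Proof. by rewrite {1}(frame_expand v) g_sumr; apply: eq_bigr => a _; rewrite gZr mulrC. Qed.

Definition orthonormal n (f : 'I_n -> V) := forall i j, g (f i) (f j) = (i == j)%:R.

(** The projections of the frame vectors to the orthogonal complement of f have
    squared norms adding up to 5 - n, so one of them can be normalized. *)
Lemma orthonormal_extend n (f : 'I_n -> V) : (n < 5)%N -> orthonormal f ->
  exists2 u, g u u = 1 & forall i, g u (f i) = 0.
Proof.
move=> n5 fo; pose w b := e b - \sum_i g (e b) (f i) *: f i.
have wf b i : g (w b) (f i) = 0.
  rewrite gDl gNl g_suml (bigD1 i) //= gZl fo eqxx mulr1 big1 ?addr0 ?subrr // => j ji.
  by rewrite gZl fo (negbTE ji) mulr0.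
have ww b : g (w b) (w b) = 1 - \sum_i g (e b) (f i) ^+ 2.
  rewrite {2}/w gDr gNr g_sumr [X in _ - X]big1 ?subr0; last by move=> i _; rewrite gZr wf mulr0.
  rewrite gDl gNl e_orth eqxx g_suml; congr (_ - _).
  by apply: eq_bigr => i _; rewrite gZl expr2; congr (_ * _); exact: g_sym.
have sw : \sum_b g (w b) (w b) = 5%:R - n%:R.
  under eq_bigr do rewrite ww; rewrite sumrB sumr_const card_ord exchange_big /=.
  congr (_ - _); rewrite -[n in RHS]card_ord -sumr_const; apply: eq_bigr => i _.
  transitivity (g (f i) (f i)); last by rewrite fo eqxx.
  rewrite parseval.
  by apply: eq_bigr => b _; rewrite expr2 (g_sym (e b)).
have [b wb] : exists b, 0 < g (w b) (w b).
  apply/not_existsP => h; have : \sum_b g (w b) (w b) <= 0.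
    by apply: sumr_le0 => b _; rewrite leNgt; apply/negP.
  by rewrite sw leNgt subr_gt0 ltr_nat n5.
exists ((Num.sqrt (g (w b) (w b)))^-1 *: w b).
  rewrite gZl gZr mulrA -invfM -expr2 sqr_sqrtr ?ltW // mulVf //.
  by rewrite gt_eqF.
by move=> i; rewrite gZl wf mulr0.
Qed.

(** A one-sided inverse of a square matrix is two-sided. *)
Lemma orthonormal_basis (f : 'I_5 -> V) b : orthonormal f -> e b = \sum_i g (e b) (f i) *: f i.
Proof.
move=> fo; pose O : 'M[R]_5 := \matrix_(i, a) g (f i) (e a).
have OO : O *m O^T = 1%:M.
  apply/matrixP => i j; rewrite !mxE -fo parseval.
  by apply: eq_bigr => a _; rewrite !mxE.
have /matrixP O1 := mulmx1C OO.
transitivity (\sum_i \sum_a (g (e b) (f i) * g (f i) (e a)) *: e a).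
  rewrite exchange_big /= (bigD1 b) //= -scaler_suml.
  have -> : \sum_i g (e b) (f i) * g (f i) (e b) = 1.
    have := O1 b b; rewrite !mxE eqxx mulr1n => OE; rewrite -[RHS]OE.
    by apply: eq_bigr => i _; rewrite !mxE (g_sym (e b)).
  rewrite scale1r big1 ?addr0 // => a ab; rewrite -scaler_suml.
  have -> : \sum_i g (e b) (f i) * g (f i) (e a) = 0.
    have := O1 b a; rewrite !mxE eq_sym (negbTE ab) mulr0n => OE; rewrite -[RHS]OE.
    by apply: eq_bigr => i _; rewrite !mxE (g_sym (e b)).
  by rewrite scale0r.
apply: eq_bigr => i _.
transitivity (g (e b) (f i) *: \sum_a g (f i) (e a) *: e a); last by rewrite -frame_expand.
rewrite scaler_sumr.
by apply: eq_bigr => a _; rewrite scalerA.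
Qed.

Section Contact.
Hypothesis K : contact_tensors g phi xi.
Local Notation phi_lin := (contact_phi_lin K).
Local Notation phi_phi := (contact_phi_phi K).
Local Notation phi_skew := (contact_phi_skew K).
Local Notation xi_unit := (contact_xi_unit K).
Local Notation phi_xi := (contact_phi_xi K).

Lemma phi_horizontal u : g (phi u) xi = 0.
Proof. by rewrite phi_skew phi_xi g0r oppr0. Qed.

Lemma phi0 : phi 0 = 0.
Proof. by apply: (addIr (phi 0)); rewrite -{1}[phi 0]scale1r -phi_lin scale1r !add0r. Qed.

Lemma phiD u v : phi (u + v) = phi u + phi v.
Proof. by rewrite -{1}[u]scale1r phi_lin scale1r. Qed.

Lemma phiZ a u : phi (a *: u) = a *: phi u.
Proof. by rewrite -{1}[a *: u]addr0 phi_lin phi0 addr0. Qed.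

Lemma phiN u : phi (- u) = - phi u.
Proof. by rewrite -(scaleN1r u) -(scaleN1r (phi u)) phiZ. Qed.

Lemma phi_sum (I : finType) (F : I -> V) : phi (\sum_a F a) = \sum_a phi (F a).
Proof. by elim/big_rec2: _ => [|a x y _ <-]; rewrite ?phi0 ?phiD. Qed.

Lemma phi_phi_horizontal u : g u xi = 0 -> phi (phi u) = - u.
Proof. by move=> h; rewrite phi_phi h scale0r addr0. Qed.

Lemma phi_isometry u v : g u xi = 0 -> g (phi u) (phi v) = g u v.
Proof.
by move=> h; rewrite g_sym phi_skew phi_phi_horizontal // gNr opprK g_sym.
Qed.

Lemma phi_orth u : g u (phi u) = 0.
Proof. by have := phi_skew u u; rewrite g_sym => h; lra. Qed.

(** The vectors v1, phi v1, v3, phi v3, xi are an adapted orthonormal basis. *)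
Lemma adapted_basis : exists v1 v3,
  [/\ g v1 v1 = 1, g v3 v3 = 1, g v1 xi = 0, g v3 xi = 0 & (g v1 v3 = 0 /\ g (phi v1) v3 = 0)].
Proof.
have [v1 v11 v1x] : exists2 u, g u u = 1 & forall i : 'I_1, g u xi = 0.
  by apply: (@orthonormal_extend 1 (fun=> xi)) => // i j; rewrite xi_unit !ord1.
have {}v1x := v1x ord0.
pose s := [:: xi; v1; phi v1].
have so : orthonormal (fun i : 'I_3 => nth 0 s i).
  have f3 (P : 'I_3 -> Prop) : P ord0 -> P (lift ord0 ord0) -> P (lift ord0 (lift ord0 ord0)) -> forall j, P j.
    move=> P0 P1 P2 j; case: (unliftP ord0 j) => [j1 ->|->] //.
    by case: (unliftP ord0 j1) => [j2 ->|->] //; rewrite (ord1 j2).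
  apply: (@f3); apply: (@f3); rewrite /= ?xi_unit ?v11 ?phi_orth ?phi_horizontal ?v1x //.
  - by rewrite g_sym v1x.
  - by rewrite g_sym phi_horizontal.
  - by rewrite g_sym phi_orth.
  - by rewrite phi_isometry.
have [v3 v33 v3s] := @orthonormal_extend 3 _ isT so.
exists v1, v3; split => //; first exact: (v3s ord0).
split; first by rewrite g_sym; exact: (v3s (lift ord0 ord0)).
by rewrite g_sym; exact: (v3s (lift ord0 (lift ord0 ord0))).
Qed.

Section Clifford.
Context (gam : 'I_5 -> 'M[C]_4).
Hypothesis hgam : clifford_gen gam.

(** Clifford multiplication by a tangent vector, in the frame e. *)
Definition hat (v : V) : 'M[C]_4 := \sum_a (g v (e a))%:C *: gam a.

Lemma hatD u v : hat (u + v) = hat u + hat v.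
Proof. by rewrite /hat -big_split; apply: eq_bigr => a _; rewrite gDl rmorphD scalerDl. Qed.

Lemma hatZ a u : hat (a *: u) = a%:C *: hat u.
Proof. by rewrite /hat scaler_sumr; apply: eq_bigr => b _; rewrite gZl rmorphM scalerA. Qed.

Lemma hat0 : hat 0 = 0.
Proof. by rewrite -(scale0r (0 : V)) hatZ scale0r. Qed.

Lemma hatN u : hat (- u) = - hat u.
Proof. by rewrite -scaleN1r hatZ rmorphN rmorph1 scaleN1r. Qed.

Lemma hat_sum (I : finType) (F : I -> V) : hat (\sum_a F a) = \sum_a hat (F a).
Proof. by elim/big_rec2: _ => [|a x y _ <-]; rewrite ?hat0 ?hatD. Qed.

Lemma hat_frame a : hat (e a) = gam a.
Proof.
rewrite /hat (bigD1 a) //= e_orth eqxx scale1r big1 ?addr0 // => b ba.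
by rewrite e_orth eq_sym (negbTE ba) scale0r.
Qed.

Lemma hat_clifford u v : hat u *m hat v + hat v *m hat u = (- (2 * (g u v)%:C))%:M.
Proof.
have -> : hat v *m hat u = \sum_a \sum_b (g u (e a) * g v (e b))%:C *: (gam b *m gam a).
  rewrite /hat mulmx_suml exchange_big; apply: eq_bigr => b _; rewrite mulmx_sumr.
  by apply: eq_bigr => a _; rewrite -scalemxAl -scalemxAr scalerA rmorphM mulrC.
have -> : hat u *m hat v = \sum_a \sum_b (g u (e a) * g v (e b))%:C *: (gam a *m gam b).
  rewrite /hat mulmx_suml; apply: eq_bigr => a _; rewrite mulmx_sumr.
  by apply: eq_bigr => b _; rewrite -scalemxAl -scalemxAr scalerA rmorphM.
rewrite -big_split (parseval u v) rmorph_sum mulr_sumr -sumrN raddf_sum; apply: eq_bigr => a _.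
rewrite -big_split /= (bigD1 a) //= -scalerDr hgam eqxx mulr1 big1 ?addr0; last first.
  by move=> b ba; rewrite -scalerDr hgam eq_sym (negbTE ba) mulr0 oppr0 raddf0 scaler0.
by rewrite scale_scalar_mx; congr (_%:M); rewrite rmorphM; ring.
Qed.

Lemma hat_anti u v : g u v = 0 -> hat u *m hat v = - (hat v *m hat u).
Proof.
move=> uv; have := hat_clifford u v; rewrite uv rmorph0 mulr0 oppr0 raddf0 => h.
by apply: (addIr (hat v *m hat u)); rewrite h addNr.
Qed.

Lemma two_neq0 : (2 : C) != 0. Proof. by rewrite pnatr_eq0. Qed.

Lemma hat_sq u : g u u = 1 -> hat u *m hat u = - 1%:M.
Proof.
move=> uu; apply: (scalerI two_neq0); have := hat_clifford u u.
by rewrite uu rmorph1 mulr1 -mulr2n -scaler_nat => ->; rewrite raddfN scalerN scalemx1.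
Qed.

Definition skew (om : 'I_5 -> 'I_5 -> R) := forall j k, om j k = - om k j.

Lemma skew_diag om j : skew om -> om j j = 0.
Proof. by move=> /(_ j j) h; lra. Qed.

Lemma cliff2_full om : skew om ->
  2 *: cliff2 gam om = \sum_j \sum_k (om j k)%:C *: (gam j *m gam k).
Proof.
move=> sk; rewrite /cliff2.
pose t j k := (om j k)%:C *: (gam j *m gam k).
have tt j k : t j k = t k j.
  have [->//|jk] := eqVneq j k.
  by rewrite /t sk rmorphN scaleNr -scalerN (clifford_anti hgam jk) opprK.
have split_jk : \sum_j \sum_k t j k =
    \sum_(j < 5) \sum_(k < 5 | (j < k)%N) t j k + \sum_(j < 5) \sum_(k < 5 | (k < j)%N) t j k.
  rewrite -big_split; apply: eq_bigr => j _ /=.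
  rewrite (bigID (fun k : 'I_5 => (j < k)%N)) /=; congr (_ + _).
  rewrite (bigD1 j) ?ltnn //= /t skew_diag // scale0r add0r.
  apply: eq_bigl => k; rewrite -leqNgt ltn_neqAle andbC.
  by congr (_ && _); rewrite -val_eqE.
rewrite split_jk scaler_nat mulr2n; congr (_ + _).
rewrite [RHS](exchange_big_dep xpredT) //=; apply: eq_bigr => j _.
by apply: eq_bigr => k _; rewrite tt.
Qed.

Lemma cliff2D om om' : cliff2 gam (fun j k => om j k + om' j k) = cliff2 gam om + cliff2 gam om'.
Proof.
rewrite /cliff2 -big_split; apply: eq_bigr => j _; rewrite -big_split.
by apply: eq_bigr => k _; rewrite rmorphD scalerDl.
Qed.

Lemma cliff2Z a om : cliff2 gam (fun j k => a * om j k) = a%:C *: cliff2 gam om.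
Proof.
rewrite /cliff2 scaler_sumr; apply: eq_bigr => j _; rewrite scaler_sumr.
by apply: eq_bigr => k _; rewrite rmorphM scalerA.
Qed.

Lemma cliff2_comm_gen om b : skew om ->
  cliff2 gam om *m gam b - gam b *m cliff2 gam om = \sum_k (2 * (om b k)%:C) *: gam k.
Proof.
move=> sk; apply: (scalerI two_neq0).
rewrite scalerBr scalemxAl scalemxAr cliff2_full // mulmx_suml mulmx_sumr.
have comm j k : gam j *m gam k *m gam b - gam b *m (gam j *m gam k) =
    (2 * (j == b)%:R) *: gam k - (2 * (k == b)%:R) *: gam j.
  have -> : gam j *m gam k *m gam b = gam j *m (gam k *m gam b + gam b *m gam k) - gam j *m gam b *m gam k.
    by rewrite mulmxDr !mulmxA addrK.
  have -> : gam b *m (gam j *m gam k) = (gam j *m gam b + gam b *m gam j) *m gam k - gam j *m gam b *m gam k.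
    by rewrite mulmxDl !mulmxA addrAC subrr add0r.
  rewrite !hgam mul_mx_scalar mul_scalar_mx opprB addrA subrK !scaleNr opprK addrC //.
rewrite -sumrB; under eq_bigr => j _.
  rewrite mulmx_suml mulmx_sumr -sumrB.
  under eq_bigr => k _ do rewrite -scalemxAl -scalemxAr -scalerBr comm scalerBr !scalerA.
  rewrite sumrB; over.
rewrite sumrB /= exchange_big /=.
have -> : \sum_(j < 5) \sum_(i < 5) ((om i j)%:C * (2 * (i == b)%:R)) *: gam j =
    \sum_k (2 * (om b k)%:C) *: gam k.
  apply: eq_bigr => k _; rewrite (bigD1 b) //= eqxx mulr1 mulrC big1 ?addr0 // => j jb.
  by rewrite (negbTE jb) !mulr0 scale0r.
have -> : \sum_(i < 5) \sum_(i0 < 5) ((om i i0)%:C * (2 * (i0 == b)%:R)) *: gam i =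
    - \sum_k (2 * (om b k)%:C) *: gam k.
  rewrite -sumrN; apply: eq_bigr => k _; rewrite (bigD1 b) //= eqxx mulr1 mulrC big1 ?addr0 => [|j jb].
    by rewrite sk rmorphN mulrN scaleNr.
  by rewrite (negbTE jb) !mulr0 scale0r.
by rewrite opprK -mulr2n scaler_nat.
Qed.

(** Half the Clifford commutator is the isomorphism spin(5) = so(5); this is what
    makes the spin connection a lift of the connection on vector fields. *)
Lemma cliff2_comm om v : skew om ->
  cliff2 gam om *m hat v - hat v *m cliff2 gam om =
  2 *: hat (\sum_k (\sum_b om b k * g v (e b)) *: e k).
Proof.
move=> sk.
have -> : hat (\sum_k (\sum_b om b k * g v (e b)) *: e k) =
    \sum_k \sum_b (om b k * g v (e b))%:C *: gam k.
  rewrite hat_sum; apply: eq_bigr => k _; rewrite hatZ hat_frame rmorph_sum scaler_suml //.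
have := fun b => cliff2_comm_gen b sk; move: (cliff2 gam om) => Om comm.
rewrite {1 2}/hat mulmx_suml mulmx_sumr -sumrB exchange_big /= scaler_sumr.
apply: eq_bigr => b _; rewrite -scalemxAl -scalemxAr -scalerBr comm !scaler_sumr.
by apply: eq_bigr => k _; rewrite !scalerA rmorphM; congr (_ *: _); ring.
Qed.

Lemma cliff2_wedge u v : g u v = 0 ->
  cliff2 gam (fun j k => g u (e j) * g v (e k) - g u (e k) * g v (e j)) = hat u *m hat v.
Proof.
move=> uv; apply: (scalerI two_neq0).
rewrite cliff2_full; last by move=> j k; rewrite opprB.
have hatM (x y : V) : hat x *m hat y = \sum_j \sum_k (g x (e j) * g y (e k))%:C *: (gam j *m gam k).
  rewrite /hat mulmx_suml; apply: eq_bigr => j _; rewrite mulmx_sumr.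
  by apply: eq_bigr => k _; rewrite -scalemxAl -scalemxAr scalerA rmorphM.
rewrite scaler_nat mulr2n {2}(hat_anti uv) !hatM -sumrB; apply: eq_bigr => j _.
rewrite -sumrB; apply: eq_bigr => k _; rewrite -scalerBl -rmorphB /=; congr (_ *: _).
by congr (_%:C); ring.
Qed.

Section ChargeConj.
Context (B : 'M[C]_4).
Hypotheses (uB : B \in unitmx) (BT : B^T = - B) (Bgam : forall j, B *m gam j = (gam j)^T *m B).

Lemma hat_conj v : B *m hat v = (hat v)^T *m B.
Proof.
rewrite /hat mulmx_sumr raddf_sum /= mulmx_suml; apply: eq_bigr => a _.
by rewrite [(_ *: _)^T]linearZ /= -scalemxAr -scalemxAl Bgam.
Qed.

Lemma cliff2_conj om : (cliff2 gam om)^T *m B = - (B *m cliff2 gam om).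
Proof.
rewrite /cliff2 raddf_sum mulmx_suml mulmx_sumr -sumrN; apply: eq_bigr => j _.
rewrite raddf_sum mulmx_suml mulmx_sumr -sumrN; apply: eq_bigr => k jk /=.
rewrite linearZ /= -scalemxAl -scalemxAr -scalerN trmx_mul -mulmxA -Bgam mulmxA -Bgam.
rewrite -mulmxA (clifford_anti hgam) ?mulmxN //.
by apply: contraTneq jk => ->; rewrite ltnn.
Qed.

Context (psi : 'cV[C]_4).
Local Notation beta := (quad B psi).

Lemma betaD A A' : beta (A + A') = beta A + beta A'.
Proof. by rewrite /quad mulmxDr mulmxDl mxE. Qed.

Lemma betaZ a A : beta (a *: A) = a * beta A.
Proof. by rewrite /quad -scalemxAr -scalemxAl mxE. Qed.

Lemma betaN A : beta (- A) = - beta A.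
Proof. by rewrite -scaleN1r betaZ mulN1r. Qed.

Lemma beta0 : beta 0 = 0.
Proof. by rewrite /quad mulmx0 mul0mx mxE. Qed.

(** B is alternating, so beta is blind to scalars. *)
Lemma beta1 a : beta a%:M = 0.
Proof.
rewrite -scalemx1 betaZ /quad mulmx1; set t := _ 0 0.
suff : t = - t by move=> /(eq_opp0 two_neq0) ->; rewrite mulr0.
rewrite {1}/t -[_ *m psi]trmxK mxE !trmx_mul trmxK BT mulNmx mulmxN mxE.
by rewrite mulmxA.
Qed.

(** Clifford multiplication by the two-form d eta (u, w) = 2 g (u, phi w), see
    OmegaE. This expression, bilinear in the frame, can be evaluated in any
    orthonormal basis. *)
Definition Omega : 'M[C]_4 := \sum_b hat (phi (e b)) *m gam b.

Lemma phi_form_skew : skew (fun j k => g (e j) (phi (e k))).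
Proof. by move=> j k; rewrite g_sym phi_skew. Qed.

Lemma OmegaE : Omega = 2 *: cliff2 gam (fun j k => g (e j) (phi (e k))).
Proof.
rewrite (cliff2_full phi_form_skew) exchange_big /=; apply: eq_bigr => b _.
rewrite /hat mulmx_suml; apply: eq_bigr => a _.
by rewrite -scalemxAl g_sym.
Qed.

Lemma Omega_comm v : Omega *m hat v - hat v *m Omega = - (4%:R *: hat (phi v)).
Proof.
rewrite OmegaE -scalemxAl -scalemxAr -scalerBr (cliff2_comm _ phi_form_skew) scalerA.
rewrite -scalerN -hatN; congr (_ *: _); first by ring.
congr hat; rewrite [RHS]frame_expand; apply: eq_bigr => k _; congr (_ *: _).
rewrite gNl phi_skew opprK [RHS]parseval; apply: eq_bigr => b _.
by rewrite mulrC; congr (_ * _); exact: g_sym.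
Qed.

(** The contraction v _| (eta /\ d eta) in the frame, with d eta written as above. *)
Definition tform v j k := g v xi * (2 * g (e j) (phi (e k)))
  + g (e j) xi * (2 * g (e k) (phi v)) + g (e k) xi * (2 * g v (phi (e j))).

Lemma cliff2_tform v :
  cliff2 gam (tform v) = (g v xi)%:C *: Omega + 2 *: (hat xi *m hat (phi v)).
Proof.
have -> : tform v = (fun j k => (g v xi * 2) * g (e j) (phi (e k)) +
    2 * (g xi (e j) * g (phi v) (e k) - g xi (e k) * g (phi v) (e j))).
  apply/funext => j; apply/funext => k; rewrite /tform !(g_sym xi) !(g_sym (phi v)).
  have := phi_skew v (e j); rewrite g_sym => ->; ring.
rewrite cliff2D !cliff2Z cliff2_wedge; last by rewrite g_sym phi_horizontal.
by rewrite OmegaE scalerA rmorphM !rmorph_nat.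
Qed.

(** Omega commutes with xi, and its commutator with phi v is 4 v for horizontal v;
    the Reeb component of v contributes the scalar xi xi, which beta ignores. *)
Lemma beta_comm_Omega v :
  beta (cliff2 gam (tform v) *m Omega - Omega *m cliff2 gam (tform v)) =
  - 8%:R * beta (hat xi *m hat v).
Proof.
have xiO : Omega *m hat xi = hat xi *m Omega.
  by apply/eqP; rewrite -subr_eq0 Omega_comm phi_xi hat0 scaler0 oppr0.
have wO := Omega_comm (phi v).
rewrite cliff2_tform mulmxDl mulmxDr -!scalemxAl -!scalemxAr opprD addrACA subrr add0r -scalerBr.
have -> : hat xi *m hat (phi v) *m Omega - Omega *m (hat xi *m hat (phi v)) =
    hat xi *m (4%:R *: hat (phi (phi v))).
  rewrite -[_ *: _]opprK -wO mulmxN mulmxBr !mulmxA xiO opprB //.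
rewrite -scalemxAr scalerA phi_phi hatD hatN hatZ mulmxDr mulmxN -scalemxAr.
rewrite (hat_sq xi_unit) betaZ betaD betaN scalerN -scaleNr scalemx1 beta1 addr0 mulrN -mulNr.
by congr (_ * _); ring.
Qed.

(** For horizontal w the torsion two-form is 2 xi /\ phi w, and the two factors xi
    of the commutator cancel. *)
Lemma comm_tform_horizontal v w : g v xi = 0 -> g w xi = 0 ->
  cliff2 gam (tform w) *m (hat xi *m hat v) - (hat xi *m hat v) *m cliff2 gam (tform w) =
  2 *: (hat (phi w) *m hat v - hat v *m hat (phi w)).
Proof.
move=> vx wx; rewrite cliff2_tform wx scale0r add0r -scalemxAl -scalemxAr -scalerBr.
congr (2 *: _).
have xx : hat xi *m hat xi = - 1%:M := hat_sq xi_unit.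
have anti u : g u xi = 0 -> hat u *m hat xi = - (hat xi *m hat u) by move=> h; exact: hat_anti.
have step (A A' : 'M[C]_4) : A *m hat xi = - (hat xi *m A) ->
    hat xi *m A *m (hat xi *m A') = A *m A'.
  by move=> h; rewrite mulmxA -(mulmxA (hat xi) A) h mulmxN (mulmxA (hat xi) (hat xi)) xx !mulNmx opprK mul1mx.
by rewrite (step _ _ (anti _ (phi_horizontal w))) (step _ _ (anti _ vx)).
Qed.

(** The Reeb direction drops out since beta vanishes on scalars. *)
Lemma beta_reeb_mod v w c : beta (hat xi *m hat (v - w - c *: xi)) =
  beta (hat xi *m hat v) - beta (hat xi *m hat w).
Proof.
have -> : hat xi *m hat (v - w - c *: xi) =
    hat xi *m hat v + (- (hat xi *m hat w) + (c%:C)%:M).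
  rewrite (hatD (v - w)) (hatD v) !hatN hatZ !mulmxDr !mulmxN -scalemxAr.
  by rewrite (hat_sq xi_unit) scalerN opprK scalemx1 addrA.
by rewrite betaD betaD betaN beta1 addr0.
Qed.

Definition comm_form u v := beta (hat u *m hat v - hat v *m hat u).

Lemma comm_form_orth u v : g u v = 0 -> comm_form u v = 2 * beta (hat u *m hat v).
Proof.
move=> uv; rewrite /comm_form (hat_anti (u := v)) 1?g_sym // opprK -mulr2n -scaler_nat betaZ //.
Qed.

Lemma comm_formDl u u' v : comm_form (u + u') v = comm_form u v + comm_form u' v.
Proof. by rewrite /comm_form !hatD mulmxDl mulmxDr opprD addrACA betaD. Qed.

Lemma comm_formZl a u v : comm_form (a *: u) v = a%:C * comm_form u v.
Proof. by rewrite /comm_form !hatZ -scalemxAl -scalemxAr -scalerBr betaZ. Qed.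

Lemma comm_form_skew u v : comm_form u v = - comm_form v u.
Proof. by rewrite /comm_form -betaN opprB. Qed.

Lemma comm_formDr u v v' : comm_form u (v + v') = comm_form u v + comm_form u v'.
Proof. by rewrite !(comm_form_skew u) comm_formDl opprD. Qed.

Lemma comm_formZr a u v : comm_form u (a *: v) = a%:C * comm_form u v.
Proof. by rewrite !(comm_form_skew u) comm_formZl mulrN. Qed.

Lemma comm_form0l v : comm_form 0 v = 0.
Proof. by rewrite -(scale0r (0 : V)) comm_formZl mul0r. Qed.

Lemma comm_form0r v : comm_form v 0 = 0.
Proof. by rewrite comm_form_skew comm_form0l oppr0. Qed.

Lemma comm_form_suml (I : finType) (F : I -> V) v : comm_form (\sum_a F a) v = \sum_a comm_form (F a) v.
Proof. by elim/big_rec2: _ => [|a x y _ <-]; rewrite ?comm_form0l ?comm_formDl. Qed.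

Lemma comm_form_sumr (I : finType) (F : I -> V) v : comm_form v (\sum_a F a) = \sum_a comm_form v (F a).
Proof. by elim/big_rec2: _ => [|a x y _ <-]; rewrite ?comm_form0r ?comm_formDr. Qed.

Lemma comm_form_phi_expand u v : comm_form (phi (phi u)) (phi v) =
  \sum_a \sum_b (g u (e a) * g v (e b))%:C * comm_form (phi (phi (e a))) (phi (e b)).
Proof.
rewrite {1}(frame_expand u) {1}(frame_expand v) !phi_sum comm_form_suml; apply: eq_bigr => a _.
rewrite comm_form_sumr; apply: eq_bigr => b _.
by rewrite !phiZ comm_formZl comm_formZr mulrA -rmorphM.
Qed.


Section Adapted.
Context (v1 v3 : V).
Hypotheses (v11 : g v1 v1 = 1) (v33 : g v3 v3 = 1) (v1x : g v1 xi = 0) (v3x : g v3 xi = 0)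
  (v13 : g v1 v3 = 0) (v23 : g (phi v1) v3 = 0).

Let v22 : g (phi v1) (phi v1) = 1. Proof. by rewrite phi_isometry. Qed.
Let v44 : g (phi v3) (phi v3) = 1. Proof. by rewrite phi_isometry. Qed.
Let v24 : g (phi v1) (phi v3) = 0. Proof. by rewrite phi_isometry. Qed.
Let v14 : g v1 (phi v3) = 0. Proof. by rewrite -[LHS]opprK -phi_skew v23 oppr0. Qed.

Lemma Omega_adapted : Omega =
  - (2 *: (hat v1 *m hat (phi v1) + hat v3 *m hat (phi v3))).
Proof.
pose s := [:: v1; phi v1; v3; phi v3; xi].
have fo : orthonormal (fun i : 'I_5 => nth 0 s i).
  have f5 (P : 'I_5 -> Prop) : P ord0 -> P (lift ord0 ord0) -> P (lift ord0 (lift ord0 ord0)) ->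
      P (lift ord0 (lift ord0 (lift ord0 ord0))) ->
      P (lift ord0 (lift ord0 (lift ord0 (lift ord0 ord0)))) -> forall j, P j.
    move=> P0 P1 P2 P3 P4 j; case: (unliftP ord0 j) => [j1 ->|->] //.
    by move: j1; apply: forall4.
  apply: (@f5); apply: (@f5); rewrite /= ?(g_sym xi) ?(g_sym (phi _) v1) ?(g_sym (phi v3)) ?(g_sym v3 v1)
     ?(g_sym v3 (phi v1)) ?phi_orth ?phi_horizontal ?xi_unit //;
    by rewrite g_sym phi_horizontal.
have -> : Omega = \sum_(i < 5) hat (phi (nth 0 s i)) *m hat (nth 0 s i).
  rewrite /Omega.
  transitivity (\sum_b \sum_(i < 5) (g (e b) (nth 0 s i))%:C *: (hat (phi (nth 0 s i)) *m gam b)).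
    apply: eq_bigr => b _; rewrite {1}(orthonormal_basis b fo) phi_sum hat_sum mulmx_suml.
    by apply: eq_bigr => i _; rewrite phiZ hatZ scalemxAl.
  rewrite exchange_big; apply: eq_bigr => i _ /=.
  rewrite {3}/hat mulmx_sumr; apply: eq_bigr => b _.
  by rewrite -scalemxAr g_sym.
rewrite !big_ord_recl big_ord0 /= phi_xi hat0 mul0mx !addr0.
rewrite !phi_phi_horizontal // !hatN !mulNmx.
rewrite (hat_anti (u := phi v1) (v := v1)) 1?g_sym ?phi_orth //.
rewrite (hat_anti (u := phi v3) (v := v3)) 1?g_sym ?phi_orth //.
move: (hat v1 *m hat (phi v1)) (hat v3 *m hat (phi v3)) => A A'.
by rewrite scaler_nat mulr2n opprD opprD addrACA -!addrA.
Qed.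

Let im : C := 0 +i* 1.
Let im2 : im * im = -1.
Proof. by apply/eqP; rewrite eq_complex /= !(mul0r, mulr0, mul1r, addr0, oppr0, sub0r) !eqxx. Qed.

Let h11 := hat_sq v11. Let h22 := hat_sq v22. Let h33 := hat_sq v33. Let h44 := hat_sq v44.
Let h12 := hat_anti (phi_orth v1). Let h13 := hat_anti v13. Let h14 := hat_anti v14.
Let h23 := hat_anti v23. Let h24 := hat_anti v24. Let h34 := hat_anti (phi_orth v3).

Lemma beta_Omega_adapted :
  comm_form (phi v1) v3 = comm_form (phi v3) v1 -> comm_form (phi v1) (phi v3) = comm_form v1 v3 -> beta Omega = 0.
Proof.
have v41 : g (phi v3) v1 = 0 by rewrite g_sym.
rewrite (comm_form_orth v23) (comm_form_orth v41) (comm_form_orth v24) (comm_form_orth v13) => e1 e2.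
have {}e1 := mulfI two_neq0 e1; have {}e2 := mulfI two_neq0 e2.
rewrite Omega_adapted betaN betaZ.
have -> := @quad_skew_types C im im2 two_neq0 _ _ _ _ B psi h11 h22 h33 h44 h12 h13 h14 h23 h24 h34
  uB (hat_conj v1) (hat_conj (phi v1)) (hat_conj v3) (hat_conj (phi v3)) (esym e2) _.
  by rewrite mulr0 oppr0.
by rewrite e1 h14 betaN.
Qed.

Lemma psi_adapted_eq0 : (forall u v, g u xi = 0 -> g v xi = 0 -> comm_form u v = 0) -> psi = 0.
Proof.
move=> H.
have b0 u v : g u xi = 0 -> g v xi = 0 -> g u v = 0 -> beta (hat u *m hat v) = 0.
  move=> ux vx uv; have := H u v ux vx; rewrite comm_form_orth // => /eqP.
  by rewrite mulf_eq0 (negbTE two_neq0) => /eqP.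
have px := phi_horizontal.
exact: (@quad_horizontal0 C im im2 two_neq0 _ _ _ _ B psi h11 h22 h33 h44 h12 h13 h14 h23 h24 h34
  uB (hat_conj v1) (hat_conj (phi v1)) (hat_conj v3) (hat_conj (phi v3))
  (b0 _ _ v1x v3x v13) (b0 _ _ (px _) (px _) v24) (b0 _ _ v1x (px _) v14) (b0 _ _ (px _) v3x v23)).
Qed.

End Adapted.

Let phi_preimage u : g u xi = 0 -> exists w, u = phi w.
Proof. by move=> h; exists (- phi u) => //; rewrite phiN phi_phi_horizontal ?opprK. Qed.

(** The hypothesis, extended by linearity, says that beta([phi u, v]) is symmetric
    in horizontal u and v, i.e. that beta vanishes on the two-forms of type
    (2,0) + (0,2). *)
Lemma beta_Omega_eq0 :
  (forall a b, comm_form (phi (phi (e a))) (phi (e b)) = comm_form (phi (phi (e b))) (phi (e a))) ->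
  beta Omega = 0.
Proof.
move=> H.
have {}H u v : g u xi = 0 -> g v xi = 0 -> comm_form (phi u) v = comm_form (phi v) u.
  move=> /phi_preimage [u' ->] /phi_preimage [v' ->].
  rewrite comm_form_phi_expand (comm_form_phi_expand v') exchange_big /=.
  by apply: eq_bigr => a _; apply: eq_bigr => b _; rewrite H; congr (_%:C * _); exact: mulrC.
have [v1 [v3 [v11 v33 v1x v3x [v13 v23]]]] := adapted_basis.
have e2 : comm_form (phi v1) (phi v3) = comm_form v1 v3.
  rewrite (H _ _ v1x (phi_horizontal v3)) (phi_phi_horizontal v3x) comm_form_skew.
  by rewrite -(scaleN1r v3) comm_formZr rmorphN rmorph1 mulN1r opprK.
exact: (beta_Omega_adapted v11 v33 v1x v3x v13 v23 (H _ _ v1x v3x) e2).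
Qed.

Lemma psi_eq0 : (forall a b, comm_form (phi (phi (e a))) (phi (e b)) = 0) -> psi = 0.
Proof.
move=> H.
have [v1 [v3 [v11 v33 v1x v3x [v13 v23]]]] := adapted_basis.
apply: (psi_adapted_eq0 v11 v33 v1x v3x v13 v23) => u v ux vx.
have [v' ->] := phi_preimage vx.
have -> : u = phi (phi (- u)) by rewrite phi_phi_horizontal ?opprK // gNl ux oppr0.
by rewrite comm_form_phi_expand big1 // => a _; rewrite big1 // => b _; rewrite H mulr0.
Qed.

End ChargeConj.
End Clifford.
End Contact.
End ContactAlgebra.

(** * Sasakian tensors and the characteristic connection *)

Section SasakianTensors.
Context (R : realType) (M : manifold5 R) (g : metric M) (S : sasakian g).
Implicit Types (p : M).

Lemma phi0_sas p : phi S (0 : tangent p) = 0.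
Proof.
have := phi_linear S 1 (0 : tangent p) 0; rewrite !scale1r addr0 => e.
by apply: (addIr (phi S (0 : tangent p))); rewrite -e add0r.
Qed.

Lemma ctformZ p a (u : tangent p) : ctform S (a *: u) = a * ctform S u.
Proof.
have e0 : ctform S (0 : tangent p) = 0.
  have := ctform_linear S 1 (0 : tangent p) 0; rewrite scale1r mul1r addr0 => e.
  by apply: (addIr (ctform S (0 : tangent p))); rewrite -e add0r.
by rewrite -[a *: u]addr0 ctform_linear e0 addr0.
Qed.

Lemma phiZ_sas p a (u : tangent p) : phi S (a *: u) = a *: phi S u.
Proof. by rewrite -[a *: u]addr0 phi_linear phi0_sas addr0. Qed.

(** phi (phi xi) = 0, so phi^3 xi = 0 makes phi xi a multiple c xi of xi, with
    c^2 = 0. *)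
Lemma phi_reeb p : phi S (reeb S p) = 0.
Proof.
have e2 : phi S (phi S (reeb S p)) = 0 by rewrite phi_phi ctform_reeb scale1r addNr.
have e3 := phi_phi S (phi S (reeb S p)).
rewrite e2 phi0_sas in e3.
have e : phi S (reeb S p) = ctform S (phi S (reeb S p)) *: reeb S p.
  by apply/eqP; rewrite -subr_eq0 -oppr_eq0 opprB addrC -e3.
have : ctform S (ctform S (phi S (reeb S p)) *: (ctform S (phi S (reeb S p)) *: reeb S p)) = 0.
  by rewrite -e -phiZ_sas -e e2 -(scale0r (reeb S p)) ctformZ mul0r.
rewrite !ctformZ ctform_reeb mulr1 => /eqP; rewrite mulf_eq0 orbb => /eqP c0.
by rewrite e c0 scale0r.
Qed.

(** Compare the two ways of reducing phi^3 u by phi^2 = -1 + eta xi. *)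
Lemma ctform_phi p (u : tangent p) : ctform S (phi S u) = 0.
Proof.
have e : phi S (phi S (phi S u)) = - phi S u.
  rewrite (phi_phi S u) addrC phi_linear phi_reeb scaler0 add0r.
  by rewrite -(scaleN1r u) phiZ_sas scaleN1r.
move: e; rewrite phi_phi => /eqP; rewrite -subr_eq0 opprK addrAC addNr add0r => /eqP e.
have := congr1 (@ctform _ _ _ S p) e; rewrite ctformZ ctform_reeb mulr1 => ->.
by rewrite -(scale0r (reeb S p)) ctformZ mul0r.
Qed.

Lemma met0 p (u : tangent p) : g p u 0 = 0.
Proof.
have e := met_linear g 1 (0 : tangent p) 0 u; rewrite scale1r mul1r addr0 in e.
by rewrite met_sym; apply: (addIr (g p 0 u)); rewrite add0r -e.
Qed.

Lemma g_reeb p (u : tangent p) : g p u (reeb S p) = ctform S u.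
Proof.
have := phi_met S u (reeb S p); rewrite phi_reeb met0 ctform_reeb mulr1.
by move=> /esym/eqP; rewrite subr_eq0 => /eqP.
Qed.

Lemma phi_skew_sas p (u v : tangent p) : g p (phi S u) v = - g p u (phi S v).
Proof.
have := phi_met S u (phi S v); rewrite ctform_phi mulr0 subr0 => <-.
rewrite phi_phi addrC !(met_sym _ (phi S u)) met_linear (met_sym _ (reeb S p)) g_reeb ctform_phi mulr0 add0r.
have := met_linear g (-1) v 0 (phi S u); rewrite addr0 scaleN1r mulN1r => ->.
by rewrite (met_sym _ 0) met0 addr0 opprK.
Qed.

Lemma sasakian_contact p : contact_tensors (@met _ _ g p) (@phi _ _ _ S p) (reeb S p).
Proof.
split; [exact: phi_linear | | exact: phi_skew_sas | | exact: phi_reeb].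
  by move=> u; rewrite phi_phi g_reeb.
by rewrite g_reeb ctform_reeb.
Qed.

Lemma sasTE U p X Y Z : open U -> U p -> smooth_vf U X -> smooth_vf U Y -> smooth_vf U Z ->
  sasT S X Y Z p = ctform S (X p) * (2 * g p (Y p) (phi S (Z p)))
   + ctform S (Y p) * (2 * g p (Z p) (phi S (X p)))
   + ctform S (Z p) * (2 * g p (X p) (phi S (Y p))).
Proof.
move=> oU Up sX sY sZ; rewrite /sasT /wedge12.
by rewrite (contact_metric S oU Up sY sZ) (contact_metric S oU Up sZ sX) (contact_metric S oU Up sX sY).
Qed.

Lemma metBl p (u v w : tangent p) : g p (u - v) w = g p u w - g p v w.
Proof. by rewrite -(scaleN1r v) addrC met_linear mulN1r addrC. Qed.

Lemma metZl p a (u w : tangent p) : g p (a *: u) w = a * g p u w.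
Proof. by rewrite -[a *: u]addr0 met_linear (met_sym g 0) met0 addr0. Qed.

(** Koszul's argument: K(X,Y,Z) = g(D_X Y - Dg_X Y, Z) is skew in Y, Z since both
    connections are metric, and K(X,Y,Z) - K(Y,X,Z) is the torsion form of D,
    which is cyclic; hence 2 K is that form. *)
Lemma skew_torsion_difference (Dg D : connection M) : levi_civita g Dg ->
  metric_connection g D ->
  (forall U p X Y Z, open U -> U p -> smooth_vf U X -> smooth_vf U Y -> smooth_vf U Z ->
     g p (torsion D X Y p) (Z p) = sasT S X Y Z p) ->
  forall U p X Y Z, open U -> U p -> smooth_vf U X -> smooth_vf U Y -> smooth_vf U Z ->
  g p (D p (X p) Y) (Z p) - g p (Dg p (X p) Y) (Z p) = 2^-1 * sasT S X Y Z p.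
Proof.
move=> [mDg tDg] mD tD U p X Y Z oU Up sX sY sZ.
have met_eq A A' A'' : smooth_vf U A' -> smooth_vf U A'' ->
    g p (D p (A p) A') (A'' p) + g p (D p (A p) A'') (A' p) =
    g p (Dg p (A p) A') (A'' p) + g p (Dg p (A p) A'') (A' p).
  move=> s' s''; rewrite !(met_sym g _ (A' p)).
  by rewrite -(mD U p (A p) A' A'') // -(mDg U p (A p) A' A'').
have tor_eq A A' A'' : smooth_vf U A -> smooth_vf U A' -> smooth_vf U A'' ->
    g p (D p (A p) A') (A'' p) - g p (D p (A' p) A) (A'' p) -
    (g p (Dg p (A p) A') (A'' p) - g p (Dg p (A' p) A) (A'' p)) = sasT S A A' A'' p.
  move=> s s' s''; rewrite -(tD U) //.
  have := tDg U p A A' oU Up s s'; rewrite /torsion => /eqP; rewrite subr_eq0 => /eqP <-.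
  by rewrite !metBl.
have cyc A A' A'' : sasT S A A' A'' p = sasT S A' A'' A p.
  by rewrite /sasT /wedge12; ring.
have := (met_eq X _ _ sY sZ, met_eq Y _ _ sX sZ, met_eq Z _ _ sX sY).
have := (tor_eq _ _ _ sX sY sZ, tor_eq _ _ _ sY sZ sX, tor_eq _ _ _ sZ sX sY).
rewrite -(cyc X Y Z) -(cyc Z X Y) => -[[t1 t2] t3] [[m1 m2] m3].
lra.
Qed.
End SasakianTensors.

Section SpinFrame.
Context (R : realType) (M : manifold5 R) (g : metric M) (gam : 'I_5 -> 'M[R[i]]_4)
  (P : spin_structure gam g).

Lemma spin_frame (i : idx P) p : dom i p ->
  orthonormal_frame (@met _ _ g p) (fun a => frame i a p).
Proof.
move=> ip; split; [exact: met_sym | exact: met_linear | exact: frame_orthonormal | exact: frame_basis].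
Qed.

(** Constant combinations of the frame extend a tangent vector to dom i, so that
    conditions on fields can be tested on vectors. *)
Lemma frame_field (i : idx P) p (v : tangent p) : dom i p ->
  exists2 X : vfield M, smooth_vf (dom i) X & X p = v.
Proof.
move=> ip; have [c ->] := frame_basis ip v.
exists (fun q => \sum_a c a *: frame i a q) => // W f oW Wi sf.
have tan_sum q (r : seq 'I_5) : (\sum_(a <- r) c a *: frame i a q) f = \sum_(a <- r) c a * frame i a q f.
  by elim: r => [|a r IH]; rewrite ?big_nil // !big_cons tangentDE IH.
rewrite (_ : (fun q => _) = (fun q => \sum_a c a * frame i a q f)); last first.
  by apply/funext => q; rewrite tan_sum.
elim: (index_enum _) => [|a r IH].
  by rewrite (_ : (fun q => _) = (fun=> 0)); [exact: smooth_on_cst | apply/funext => q; rewrite big_nil].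
rewrite (_ : (fun q => _) = (fun q => c a * frame i a q f + \sum_(b <- r) c b * frame i b q f)).
  apply: smooth_onD => //; apply: smooth_onM => //; first exact: smooth_on_cst.
  exact: (@frame_smooth _ _ _ _ P i a W f oW Wi sf).
by apply/funext => q; rewrite big_cons.
Qed.

Lemma frame_eq (i : idx P) p (u v : tangent p) : dom i p ->
  (forall a, g p u (frame i a p) = g p v (frame i a p)) -> u = v.
Proof.
move=> ip e; rewrite (frame_expand (spin_frame ip) u) (frame_expand (spin_frame ip) v).
by apply: eq_bigr => a _; rewrite e.
Qed.

(** The vector dual to T(X,Y,-) exists since it is twice the difference of the
    connections, and it is unique since the spin frame spans. *)
Lemma characteristic_nabla_s (S : sasakian g) (Dg D : connection M) :
  levi_civita g Dg -> characteristic_connection S D ->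
  forall U p X Y, open U -> U p -> smooth_vf U X -> smooth_vf U Y ->
    nabla_s S Dg 4^-1 X Y p = D p (X p) Y.
Proof.
move=> hDg [mD tD _ _ _] U p X Y oU Up sX sY.
have diff V Z : open V -> V p -> smooth_vf V Z ->
    g p (2 *: (D p (X p) Y - Dg p (X p) Y)) (Z p) = sasT S X Y Z p.
  move=> oV Vp sZ; have oUV : open (U `&` V) by exact: openI.
  have sub X' : smooth_vf U X' -> smooth_vf (U `&` V) X' by apply: smooth_vf_sub => ? [].
  have sZ' : smooth_vf (U `&` V) Z by apply: smooth_vf_sub sZ => ? [].
  have := skew_torsion_difference hDg mD tD oUV (conj Up Vp) (sub _ sX) (sub _ sY) sZ'.
  by rewrite metZl metBl => ->; rewrite mulrA mulfV ?mul1r // pnatr_eq0.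
rewrite /nabla_s; have -> : sasT_vec S X Y p = 2 *: (D p (X p) Y - Dg p (X p) Y) => [|{diff}].
  apply: xget_unique => [V Z oV Vp sZ|y hy]; first exact: (diff V Z oV Vp sZ).
  have [i ip] := dom_cover P p; apply: (frame_eq ip) => a.
  have oi := dom_open i.
  by rewrite (hy _ _ oi ip (frame_smooth a)) (diff _ _ oi ip (frame_smooth a)).
rewrite scalerA (_ : 2 * 4^-1 * 2 = 1) ?scale1r ?[_ + (_ - _)]addrC ?subrK //; by field.
Qed.

End SpinFrame.

(** * Parallel spinors *)

Section SpinorCalculus.
Context (R : realType) (M : manifold5 R) (g : metric M) (S : sasakian g)
  (gam : 'I_5 -> 'M[R[i]]_4) (hgam : clifford_gen gam)
  (P : spin_structure gam g) (Dg D : connection M)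
  (hDg : levi_civita g Dg) (hD : characteristic_connection S D)
  (s : R) (psi : spinor_field P) (par : parallel_spinor S Dg s psi) (i : idx P).
Local Notation C := R[i].
Local Notation e := (fun a => frame i a).
Let U := dom i.
Let oU : open U := dom_open i.
Let se a : smooth_vf U (e a) := frame_smooth a.
Let u := s - 4^-1.

Let mD : metric_connection g D. Proof. by case: hD. Qed.
Let tD := let: And5 _ t _ _ _ := hD in t.
Let xiD p (v : tangent p) : D p v (reeb S) = 0. Proof. by case: hD. Qed.
Let phiD_par V p (v : tangent p) Y : open V -> V p -> smooth_vf V Y ->
  D p v (fun q => phi S (Y q)) = phi S (D p v Y).
Proof. by case: hD => _ _ _ _; exact. Qed.

Definition conn_form p (v : tangent p) j k : R := g p (D p v (e j)) (e k p).
Definition tors_form p (v : tangent p) : 'I_5 -> 'I_5 -> R :=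
  tform (@met _ _ g p) (fun a => frame i a p) (@phi _ _ _ S p) (reeb S p) v.
Definition vhat (Z : vfield M) p : 'M[C]_4 :=
  hat (@met _ _ g p) (fun a => frame i a p) gam (Z p).

Lemma conn_form_skew p (v : tangent p) : U p -> skew (conn_form v).
Proof.
move=> Up j k; have := mD v oU Up (se j) (se k).
have -> : v (fun q => g q (e j q) (e k q)) = 0.
  rewrite -(tan_cst v (j == k)%:R); apply: tan_near; apply: (open_near oU Up) => q Uq.
  exact: frame_orthonormal.
by rewrite (met_sym g (e j p)) => /eqP; rewrite eq_sym addr_eq0 => /eqP.
Qed.

(** The equation nabla^s psi = 0 in terms of D: replacing the Levi-Civita
    connection by D shifts the coefficient of the torsion term by 1/4. *)
Lemma parallel_derM p (v : tangent p) : U p ->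
  derM v (psi i) = - (((2^-1)%:C *: cliff2 gam (conn_form v) + u%:C *: cliff2 gam (tors_form v))
     *m psi i p).
Proof.
move=> Up; have [X sX <-] := frame_field v Up.
have := par oU (fun q h => h) Up sX; rewrite /spin_nabla_s /spin_conn.
have -> : dspinor (X p) (psi i) = derM (X p) (psi i).
  by apply/matrixP => a b; rewrite !mxE !ord1.
have tE j k : sasT S X (e j) (e k) p = tors_form (X p) j k.
  by rewrite (sasTE S oU Up sX (se j) (se k)) /tors_form /tform !g_reeb.
have -> : (fun j k => sasT S X (frame i j) (frame i k) p) = tors_form (X p).
  by apply/funext => j; apply/funext => k; exact: tE.
have -> : (fun j k => g p (Dg p (X p) (frame i j)) (frame i k p)) =
    (fun j k => conn_form (X p) j k + (- 2^-1) * tors_form (X p) j k).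
  apply/funext => j; apply/funext => k; rewrite -tE.
  have := skew_torsion_difference hDg mD tD oU Up sX (se j) (se k).
  by rewrite /conn_form => h; lra.
rewrite cliff2D cliff2Z !mulmxDl -!scalemxAl scalerDr scalerA -addrA -addrA => h.
apply/eqP; rewrite -addr_eq0 -[X in _ == X]h; apply/eqP; congr (_ + (_ + _)).
rewrite -scalerDl; congr (_ *: _).
by rewrite -rmorphM -rmorphD; congr (_%:C); rewrite /u; field.
Qed.

Definition conn_mx p (v : tangent p) : 'M[C]_4 := (2^-1)%:C *: cliff2 gam (conn_form v).

(** The section of the Clifford bundle whose matrix in the frame is A is smooth
    and has covariant derivative D_v A = A'. *)
Definition covder p (v : tangent p) (A : M -> 'M[C]_4) (A' : 'M[C]_4) : Prop :=
  smoothM_at p A /\ derM v A = A' - (conn_mx v *m A p - A p *m conn_mx v).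

Lemma covder_mul p (v : tangent p) A A' G G' : covder v A A' -> covder v G G' ->
  covder v (fun q => A q *m G q) (A' *m G p + A p *m G').
Proof.
move=> [sA dA] [sG dG]; split; first exact: smoothM_atM.
rewrite (derMM _ sA sG) dA dG.
rewrite !mulmxBl !mulmxBr !mulmxA.
move: (conn_mx v *m _ *m _) (A p *m conn_mx v *m _) (A p *m G p *m _) => a b c.
by apply/matrixP => r t; rewrite !mxE; ring.
Qed.

Lemma covder_sum p (v : tangent p) (I : finType) (A : I -> M -> 'M[C]_4) A' :
  (forall a, covder v (A a) (A' a)) -> covder v (fun q => \sum_a A a q) (\sum_a A' a).
Proof.
move=> h; split; first by apply: smoothM_at_sum => a; case: (h a).
rewrite derM_sum => [|a]; last by case: (h a).
rewrite mulmx_sumr mulmx_suml -!sumrB; apply: eq_bigr => a _.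
by case: (h a).
Qed.

(** The spin connection of D induces D on vector fields, by cliff2_comm. *)
Lemma vhat_covder V p (v : tangent p) Z : open V -> V p -> U p -> smooth_vf V Z ->
  covder v (vhat Z) (hat (@met _ _ g p) (fun a => frame i a p) gam (D p v Z)).
Proof.
move=> oV Vp Up sZ.
have oUV : open (U `&` V) by exact: openI.
have sZ' : smooth_vf (U `&` V) Z by apply: smooth_vf_sub sZ => ? [].
have se' a : smooth_vf (U `&` V) (e a) by apply: smooth_vf_sub (se a) => ? [].
have sc a : smooth_at p (fun q => g q (Z q) (e a q)).
  by exists (U `&` V); split => //; exact: met_smooth.
split; first exact: smoothM_at_comb.
rewrite derM_comb //.
rewrite /conn_mx -scalemxAl -scalemxAr -scalerBr (cliff2_comm (spin_frame Up) hgam); last exact: conn_form_skew.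
rewrite scalerA (_ : (2^-1)%:C * 2 = 1); last first.
  by rewrite -(rmorph_nat (real_complex R)) -rmorphM mulVf ?pnatr_eq0.
rewrite scale1r -(hatN (spin_frame Up)) -(hatD (spin_frame Up)) /hat; apply: eq_bigr => a _.
congr (_%:C *: _); rewrite (mD v oUV (conj Up Vp) sZ' (se' a)) (gDl (spin_frame Up)); congr (_ + _).
rewrite (gNl (spin_frame Up)) (frame_coord (spin_frame Up)).
rewrite met_sym (parseval (spin_frame Up)) -sumrN; apply: eq_bigr => b _.
by rewrite -mulNr -conn_form_skew.
Qed.

Context (B : 'M[C]_4) (uB : B \in unitmx) (BT : B^T = - B)
  (Bgam : forall j, B *m gam j = (gam j)^T *m B).

Lemma psi_smooth p : U p -> smoothM_at p (psi i).
Proof.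
move=> Up a b; rewrite (ord1 b).
by have [sr si] := spn_smooth psi i a; split; exists U.
Qed.

Lemma beta_smooth p (A : M -> 'M[C]_4) : U p -> smoothM_at p A ->
  smoothC_at p (fun q => quad B (psi i q) (A q)).
Proof.
move=> Up sA; have sp := psi_smooth Up.
have sB : smoothM_at p (fun=> B) by exact: smoothM_at_cst.
exact: (smoothM_atM (smoothM_atM (smoothM_atM (smoothM_at_tr sp) sB) sA) sp).
Qed.

(** B is invariant under the spin connection, and the torsion two-form is skew for
    B, so the derivative of psi only leaves a commutator. *)
Lemma derC_beta p (v : tangent p) (A : M -> 'M[C]_4) A' : U p -> covder v A A' ->
  derC v (fun q => quad B (psi i q) (A q)) =
  quad B (psi i p) A' +
  u%:C * quad B (psi i p) (cliff2 gam (tors_form v) *m A p - A p *m cliff2 gam (tors_form v)).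
Proof.
move=> Up [sA dA]; rewrite -betaZ -betaD; have sp := psi_smooth Up.
have sB : smoothM_at p (fun=> B) by exact: smoothM_at_cst.
have sT := smoothM_at_tr sp.
have -> : derC v (fun q => quad B (psi i q) (A q)) =
    derM v (fun q => (psi i q)^T *m B *m A q *m psi i q) 0 0 by rewrite mxE.
rewrite derMM //; [|exact: (smoothM_atM (smoothM_atM sT sB) sA)].
rewrite derMM //; [|exact: (smoothM_atM sT sB)].
rewrite derMM // derM_cst mulmx0 addr0 derM_tr (parallel_derM v Up) dA.
have LB om : (cliff2 gam om)^T *m B = - (B *m cliff2 gam om) := cliff2_conj hgam Bgam om.
rewrite -/(conn_mx v); set L := conn_mx v + _.
have LTB : L^T *m B = - (B *m L).
  by rewrite /L /conn_mx linearD !linearZ /= mulmxDl -!scalemxAl !LB mulmxDr -!scalemxAr opprD !scalerN.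
have key : L *m A p + (A' - (conn_mx v *m A p - A p *m conn_mx v)) - A p *m L =
    A' + u%:C *: (cliff2 gam (tors_form v) *m A p - A p *m cliff2 gam (tors_form v)).
  rewrite /L; move: (conn_mx v) (cliff2 gam (tors_form v)) => N T.
  rewrite mulmxDl mulmxDr -scalemxAl -scalemxAr.
  move: (N *m A p) (A p *m N) (T *m A p) (A p *m T) => a b c d.
  by apply/matrixP => r t; rewrite !mxE; ring.
rewrite raddfN /= trmx_mul mulNmx -(mulmxA _ L^T) LTB mulmxN opprK mulmxN.
rewrite /quad -key; congr (fun X : 'M[C]_1 => X 0 0).
move: (A' - _) => X; rewrite (mulmxBr _ _ (A p *m L)) (mulmxDr _ (L *m A p)) mulmxBl !mulmxA.
by [].
Qed.

(** The frame vectors are kept as fields on both sides, so that the Leibniz rule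
    applies to each factor. *)
Definition Omega_field q : 'M[C]_4 :=
  \sum_b vhat (fun r => phi S (e b r)) q *m vhat (e b) q.

Lemma phi_smooth_frame a : smooth_vf U (fun q => phi S (e a q)).
Proof. exact: phi_smooth. Qed.

Lemma Omega_fieldE p : U p ->
  Omega_field p = Omega (@met _ _ g p) (fun a => frame i a p) (@phi _ _ _ S p) gam.
Proof.
by move=> Up; apply: eq_bigr => b _; rewrite /vhat (hat_frame (spin_frame Up)).
Qed.

(** D commutes with phi, and the frame terms cancel because the connection form is
    skew while the sum over the frame is symmetric. *)
Lemma Omega_parallel p (v : tangent p) : U p -> covder v Omega_field 0.
Proof.
move=> Up; have F := spin_frame Up.
have De b : D p v (e b) = \sum_c conn_form v b c *: e c p by exact: frame_expand F _.
have -> : (0 : 'M[C]_4) = \sum_b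
   (hat (@met _ _ g p) (fun a => frame i a p) gam (D p v (fun q => phi S (e b q))) *m vhat (e b) p +
    vhat (fun r => phi S (e b r)) p *m hat (@met _ _ g p) (fun a => frame i a p) gam (D p v (e b))).
  pose t b c := vhat (fun r => phi S (e b r)) p *m vhat (e c) p.
  transitivity (\sum_b \sum_c ((conn_form v b c)%:C *: t c b + (conn_form v b c)%:C *: t b c)).
    rewrite (eq_bigr (fun b => \sum_c (conn_form v b c)%:C *: t c b + \sum_c (conn_form v b c)%:C *: t b c)); last first.
      by move=> b _; rewrite big_split.
    rewrite big_split /= exchange_big -big_split big1 // => c _ /=.
    rewrite -big_split big1 // => b _ /=.
    by rewrite -scalerDl -rmorphD (conn_form_skew v Up b c) addNr scale0r.
  apply: eq_bigr => b _; rewrite big_split /= (phiD_par v oU Up (se b)) De; congr (_ + _).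
    rewrite (phi_sum (sasakian_contact S p)) (hat_sum F) mulmx_suml; apply: eq_bigr => c _.
    by rewrite (phiZ (sasakian_contact S p)) (hatZ F) -scalemxAl.
  by rewrite (hat_sum F) mulmx_sumr; apply: eq_bigr => c _; rewrite (hatZ F) -scalemxAr.
apply: covder_sum => b; apply: covder_mul; apply: (vhat_covder _ oU Up Up) => //.
exact: phi_smooth_frame.
Qed.

Local Notation beta p := (quad B (psi i p)).
Local Notation gp p := (@met _ _ g p).
Local Notation ep p := (fun a => frame i a p).
Local Notation phat p := (hat (gp p) (ep p) gam).
Local Notation "''phi_' a" := (fun q => phi S (frame i a q)) (at level 8, a at level 2).

Definition Omega_pairing q : C := beta q (Omega_field q).
Definition reeb_pairing (Z : vfield M) q : C := beta q (vhat (reeb S) q *m vhat Z q).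

Lemma Omega_pairing_smooth p : U p -> smoothC_at p Omega_pairing.
Proof. by move=> Up; apply: beta_smooth => //; case: (Omega_parallel 0 Up). Qed.

Lemma derC_Omega_pairing p (v : tangent p) : U p ->
  derC v Omega_pairing = - (8%:R * u%:C) * beta p (phat p (reeb S p) *m phat p v).
Proof.
move=> Up; rewrite (derC_beta Up (Omega_parallel v Up)).
rewrite beta0.
rewrite (Omega_fieldE Up).
rewrite add0r.
by rewrite (beta_comm_Omega (spin_frame Up) (sasakian_contact S p) hgam BT); ring.
Qed.

Lemma reeb_pairing_smooth p a : U p -> smoothC_at p (reeb_pairing 'phi_a).
Proof.
move=> Up; apply: beta_smooth => //; apply: smoothM_atM.
  by case: (vhat_covder 0 openT I Up (reeb_smooth S)).
by case: (vhat_covder 0 oU Up Up (@phi_smooth_frame a)).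
Qed.

(** As xi is D-parallel, D_w only meets the second factor; the torsion two-form of
    the horizontal vector w supplies the commutator. *)
Lemma derC_reeb_pairing p (w : tangent p) a : U p -> g p w (reeb S p) = 0 ->
  derC w (reeb_pairing 'phi_a) = beta p (phat p (reeb S p) *m phat p (D p w 'phi_a))
    + 2 * u%:C * comm_form (gp p) (ep p) gam B (psi i p) (phi S w) (phi S (e a p)).
Proof.
move=> Up wx; have F := spin_frame Up; have K := sasakian_contact S p.
rewrite (derC_beta Up (covder_mul (vhat_covder w openT I Up (reeb_smooth S))
  (vhat_covder w oU Up Up (@phi_smooth_frame a)))).
rewrite xiD.
rewrite (hat0 F).
rewrite mul0mx.
rewrite add0r /vhat.
rewrite (comm_tform_horizontal F K hgam (phi_horizontal F K _) wx).
rewrite betaZ (mulrCA u%:C) mulrA.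
by [].
Qed.

Context (u0 : u != 0).

(** The identity [X, Y] f = X(Y f) - Y(X f) for f = beta(Omega) and the horizontal
    fields X = phi e_a, Y = phi e_b. *)
Lemma Omega_pairing_eq0 p : U p -> Omega_pairing p = 0.
Proof.
move=> Up; have F := spin_frame Up; have K := sasakian_contact S p.
have u0C : u%:C != 0 by rewrite fmorph_eq0.
rewrite /Omega_pairing Omega_fieldE //.
apply: (beta_Omega_eq0 F K hgam uB Bgam) => a b.
have sa := @phi_smooth_frame a; have sb := @phi_smooth_frame b.
have second x y : derC (phi S (e x p)) (fun q => derC (phi S (e y q)) Omega_pairing) =
    - (8%:R * u%:C) * derC (phi S (e x p)) (reeb_pairing 'phi_y).
  rewrite -derCZ; last exact: reeb_pairing_smooth.
  by apply: derC_near; apply: (open_near oU Up) => q Uq; rewrite derC_Omega_pairing.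
have := derC_lie_bracket oU Up sa sb (Omega_pairing_smooth Up).
rewrite !second.
rewrite (derC_Omega_pairing _ Up).
rewrite (derC_reeb_pairing _ Up (phi_horizontal F K _)).
rewrite (derC_reeb_pairing _ Up (phi_horizontal F K _)).
have -> : lie_bracket 'phi_a 'phi_b p = D p (phi S (e a p)) 'phi_b - D p (phi S (e b p)) 'phi_a
    - (2 * g p (phi S (e a p)) (phi S (phi S (e b p)))) *: reeb S p.
  (* On horizontal fields T(X, Y, -) = d eta (X, Y) eta. *)
  have -> : (2 * g p (phi S (e a p)) (phi S (phi S (e b p)))) *: reeb S p = torsion D 'phi_a 'phi_b p.
    apply: (frame_eq Up) => c; rewrite (tD oU Up sa sb (se c)) (sasTE S oU Up sa sb (se c)).
    by rewrite !ctform_phi !mul0r !add0r metZl (met_sym g (reeb S p)) g_reeb mulrC.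
  by rewrite /torsion opprB addrCA subrr addr0.
rewrite (beta_reeb_mod F K hgam BT).
move: (beta p _) (beta p _) (comm_form _ _ _ _ _ _ _) (comm_form _ _ _ _ _ _ _) => x y z t h.
have c0 : 16%:R * (u%:C * u%:C) != 0 :> C by rewrite !mulf_neq0 ?pnatr_eq0.
apply: (mulfI c0); apply/eqP; rewrite -subr_eq0.
move/eqP: h; rewrite -subr_eq0 => /eqP <-; apply/eqP; ring.
Qed.

(** Since beta(Omega) vanishes near p, so do its first two derivatives, which
    leaves beta([phi X, Y]) = 0 for horizontal X and Y. *)
Lemma parallel_spinor_eq0 p : U p -> psi i p = 0.
Proof.
move=> Up; have F := spin_frame Up; have K := sasakian_contact S p.
have u0C : u%:C != 0 by rewrite fmorph_eq0.
have pairing0 q (v : tangent q) : U q -> beta q (phat q (reeb S q) *m phat q v) = 0.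
  move=> Uq; have := derC_Omega_pairing v Uq.
  rewrite (_ : derC v Omega_pairing = 0).
    move=> /esym/eqP; rewrite mulf_eq0 oppr_eq0 mulf_eq0 pnatr_eq0 (negbTE u0C) /=.
    by move=> /eqP.
  rewrite -(derC_cst v 0); apply: derC_near; apply: (open_near oU Uq) => r Ur.
  exact: Omega_pairing_eq0.
apply: (psi_eq0 F K hgam uB Bgam) => a b.
have := derC_reeb_pairing b Up (phi_horizontal F K (e a p)).
rewrite pairing0 // add0r (_ : derC _ _ = 0).
  move=> /esym/eqP; rewrite !mulf_eq0 (negbTE u0C) pnatr_eq0 /=.
  by move=> /eqP.
rewrite -(derC_cst (phi S (e a p)) 0); apply: derC_near; apply: (open_near oU Up) => r Ur.
exact: pairing0.
Qed.

End SpinorCalculus.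

Theorem proposition7p2 (R : realType) (M : manifold5 R) (g : metric M)
    (S : sasakian g)
    (gam : 'I_5 -> 'M[R[i]]_4) (hgam : clifford_gen gam)
    (P : spin_structure gam g)
    (Dg : connection M) (hDg : levi_civita g Dg)
    (D : connection M) (hD : characteristic_connection S D)
    (s : R)
    (hpar : exists psi : spinor_field P,
        ~ spinor_zero psi /\ parallel_spinor S Dg s psi) :
  s = 4^-1 /\
  (forall (U : set M) (p : M) (X Y : vfield M), open U -> U p ->
     smooth_vf U X -> smooth_vf U Y ->
     nabla_s S Dg s X Y p = D p (X p) Y).
Proof.
have s4 : s = 4^-1.
  have [psi [nz par]] := hpar; apply/eqP; rewrite -subr_eq0; apply/negPn/negP => u0.
  apply: nz => i p ip.
  have im2 : (0 +i* 1) * (0 +i* 1) = -1 :> R[i].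
    by apply/eqP; rewrite eq_complex /= !(mul0r, mulr0, mul1r, addr0, oppr0, sub0r) !eqxx.
  have [B uB [BT Bgam]] := charge_conjugation im2 (two_neq0 R) hgam.
  exact: (parallel_spinor_eq0 hgam hDg hD par uB BT Bgam u0 ip).
by split=> //; rewrite s4; exact: (characteristic_nabla_s P hDg hD).
Qed.
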